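(* Let $I\subset\mathbb{R}$ be a nondegenerate interval, let $D:I^2\to\mathbb{R}$ be a deviation and let $(\xi_n)_{n\in\mathbb{N}}$ be a sequence of independent and identically distributed (real) random variables. Assume that (i) $D$ is Borel measurable in the first variable; (ii) $\mathbb{P}(\xi_1\in I)=1$ and $\xi_1$ satisfies the interior point condition with respect to $D$; (iii) $D$ is differentiable in the second variable at $t_0:=\mathbb{M}^D(\xi_1)$, and there exist $r>0$, $\alpha\in[0,\infty)$, a nonnegative Borel measurable function $H:I\to\mathbb{R}$ and a nonnegative function $h:(0,r)\to\mathbb{R}$ such that $(t_0-r,t_0+r)\subset I^D_{\xi_1}$, $$\left|\frac{D(x,t)-D(x,t_0)}{t-t_0}-\partial_2 D(x,t_0)\right|\leq H(x)\,h(|t-t_0|)\qquad\text{for all } x\in I,\ t\in(t_0-r,t_0+r),\ t\neq t_0,$$ and $$\limsup_{s\to0^+}\frac{h(s)}{s^\alpha}\ \begin{cases}=0&\text{if }\alpha=0,\\ <\infty&\text{if }\alpha>0,\end{cases}\qquad\text{and}\qquad \mathbb{E}(H(\xi_1)^q)<\infty,$$ where $q:=\frac{2}{2+\alpha}$; (iv) $0<\mathbb{E}(D(\xi_1,t_0)^2)<\infty$ and $0<\mathbb{E}(-\partial_2D(\xi_1,t_0))<\infty$. Then $$\sqrt{n}\,\big(\mathscr{M}_n^{D}(\xi_1,\ldots,\xi_n)-t_0\big)\to \mathcal{N}\left(0,\frac{\mathbb{E}(D(\xi_1,t_0)^2)}{(\mathbb{E}(\partial_2D(\xi_1,t_0)))^2}\right)\qquad\text{in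 distribution as } n\to\infty.$$
   Context: All random variables are defined on a probability space $(\Omega,\mathcal{F},\mathbb{P})$. An interval is nondegenerate if it contains at least two distinct points. $\mathcal{N}(0,\sigma^2)$ denotes the normal distribution with mean $0$ and variance $\sigma^2$. A function $D:I^2\to\mathbb{R}$ is a deviation if (a) for all $x\in I$, the function $I\ni t\mapsto D(x,t)$ is strictly decreasing and continuous, and (b) $D(t,t)=0$ for all $t\in I$. $D$ is Borel measurable in the first variable if, for all $t\in I$, the function $I\ni x\mapsto D(x,t)$ is Borel measurable. $D$ is differentiable in the second variable at $t_0$ if for every $x\in I$ the function $t\mapsto D(x,t)$ is differentiable at $t_0$; its derivative there is denoted $\partial_2D(x,t_0)$. For $n\in\mathbb{N}$ and $x_1,\dots,x_n\in I$, the deviation mean $\mathscr{M}_n^D(x_1,\dots,x_n)$ is the unique solution $t\in I$ of $\sum_{i=1}^n D(x_i,t)=0$ (it exists, is unique, and lies in $[\min_i x_i,\max_i x_i]$). Since $\mathbb{P}(\xi_i\in I,\ i\in\mathbb{N})=1$, $\mathscr{M}_n^D(\xi_1,\dots,\xi_n)$ is defined almost surely. For a random variable $\xi$ with $\mathbb{P}(\xi\in I)=1$ let $I_\xi^D:=\{t\in I : \mathbb{E}(|D(\xi,t)|)<\infty\}$, which is a (possibly degenerate) subinterval of $I$. If there exists $t_0\in I_\xi^D$ with $\mathbb{E}(D(\xi,t_0))=0$, then it is unique; it is called the $D$-deviation mean of $\xi$ and is denoted by $\mathbb{M}^D(\xi)$. If $\mathbb{M}^D(\xi)$ exists and belongs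 to the interior of $I_\xi^D$, then $\xi$ is said to satisfy the interior point condition with respect to $D$. *)

(* Defs.v *)
From HB Require Import structures.
From mathcomp Require Import all_boot all_order all_algebra finmap.
From mathcomp Require Import all_classical all_reals all_analysis.

Set Implicit Arguments.
Unset Strict Implicit.
Unset Printing Implicit Defensive.

Import Order.TTheory GRing.Theory Num.Theory.
Import numFieldNormedType.Exports.

Local Open Scope classical_set_scope.
Local Open Scope ring_scope.

Definition nondegenerate_interval (R : realType) (I : set R) : Prop :=
  is_interval I /\ exists a b, [/\ I a, I b & a != b].

(* A function I^2 -> R is encoded as D : R -> R -> R, of which only the values
   on I^2 are ever used. *)
Definition deviation (R : realType) (I : set R) (D : R -> R -> R) : Prop :=
  (forall x, I x ->
     (forall s t, I s -> I t -> s < t -> D x t < D x s) /\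
     {within I, continuous (D x)}) /\
  (forall t, I t -> D t t = 0).

Definition borel_measurable_fst (R : realType) (I : set R) (D : R -> R -> R)
    : Prop :=
  forall t, I t -> measurable_fun I (fun x => D x t).

(* Two-sided derivative of the total function [D x]: it depends only on the
   values on I^2 when x \in I and t is an interior point of I, the only case
   used. *)
Definition differentiable_snd (R : realType) (I : set R) (D : R -> R -> R)
    (t : R) : Prop :=
  forall x, I x -> derivable (D x) t 1.

Definition partial2 (R : realType) (D : R -> R -> R) (x t : R) : R :=
  derive1 (D x) t.

(* The unique t in I with \sum_i D (x i) t = 0 when n > 0 and all the x i lie
   in I; set to 0 if some x i is not in I. *)
Definition deviation_mean (R : realType) (I : set R) (D : R -> R -> R)
    (n : nat) (x : 'I_n -> R) : R :=
  xget 0 [set t | [/\ forall i, I (x i), I t & \sum_(i < n) D (x i) t = 0]].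

(* E(f(X)) for a function f defined on I only, where P(X \in I) = 1. *)
Definition expectation_on (d : measure_display) (T : measurableType d)
    (R : realType) (P : probability T R) (I : set R) (X : {RV P >-> R})
    (f : R -> R) : \bar R :=
  ('E_P[patch (fun=> 0%R) I f \o X])%E.

(* I_X^D *)
Definition deviation_domain (d : measure_display) (T : measurableType d)
    (R : realType) (P : probability T R) (I : set R) (D : R -> R -> R)
    (X : {RV P >-> R}) : set R :=
  [set t | I t /\ (expectation_on I X (fun x => `|D x t|%R) < +oo)%E].

(* t0 = M^D(X) *)
Definition is_deviation_mean_of (d : measure_display) (T : measurableType d)
    (R : realType) (P : probability T R) (I : set R) (D : R -> R -> R)
    (X : {RV P >-> R}) (t0 : R) : Prop :=
  deviation_domain I D X t0 /\ expectation_on I X (fun x => D x t0) = 0%E.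

Definition interior_point_condition (d : measure_display)
    (T : measurableType d) (R : realType) (P : probability T R) (I : set R)
    (D : R -> R -> R) (X : {RV P >-> R}) : Prop :=
  exists2 t0, is_deviation_mean_of I D X t0 &
    interior (deviation_domain I D X) t0.

Definition independent_RVs (d : measure_display) (T : measurableType d)
    (R : realType) (P : probability T R) (X : nat -> {RV P >-> R}) : Prop :=
  forall (J : {fset nat}) (B : nat -> set R),
    (forall i, measurable (B i)) ->
    P (\bigcap_(i in [set` J]) (X i @^-1` B i)) =
    (\prod_(i <- J) fine (P (X i @^-1` B i)))%:E.

Definition identically_distributed (d : measure_display)
    (T : measurableType d) (R : realType) (P : probability T R)
    (X : nat -> {RV P >-> R}) : Prop :=
  forall (n : nat) (B : set R), measurable B ->
    distribution P (X n) B = distribution P (X 0%N) B.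

Definition cvg_in_distribution (d : measure_display) (T : measurableType d)
    (R : realType) (P : probability T R) (Z : nat -> T -> R)
    (mu : probability (measurableTypeR R) R) : Prop :=
  (forall n, measurable_fun setT (Z n)) /\
  forall x : R, {for x, continuous (fun y : R => mu `]-oo, y]%classic)} ->
    P (Z n @^-1` `]-oo, x]%classic) @[n --> \oo] --> mu `]-oo, x]%classic.

(* N(m, v) for v > 0; [normal_prob] takes the standard deviation. *)
Definition normal_law (R : realType) (m v : R)
    : probability (measurableTypeR R) R :=
  normal_prob m (Num.sqrt v).

(* Main.v *)
(* Write t_n = t0 + x / sqrt n.  Since t |-> \sum_i D (xi_i) t is decreasing, the event
   M_n <= t_n is the event \sum_(i < n) D (xi_i) (t_n) <= 0, so that everything
   reduces to a central limit theorem for the i.i.d. rows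
   D (xi_i) (t_n) / (m sqrt n) + x / n,
   where m = E(- d2D(xi, t0)).  It is proved by Trotter's method: to a random variable X
   one attaches the operator f |-> (y |-> E f(y + X)); these operators contract the
   sup norm, commute with each other, and compose along sums of independent
   variables, so that the distance between the row sum and the normal law is
   at most n times the distance between one summand and N(0, sigma^2 / n).  For
   smooth f a Taylor expansion makes the latter o(1 / n), uniformly in y.  A
   summand is W / sqrt n + U / n + C_n with W, U centered and C_n the differentiability
   error; only n min(1, |C_n|) enters the expansion, and the q-th moment of H
   dominates it because min(1, z) <= z^q.  Logistic functions
   finally approximate indicators of half-lines. *)

Require Import Defs.
From HB Require Import structures.
From mathcomp Require Import all_boot all_order all_algebra finmap.
From mathcomp Require Import all_classical all_reals all_analysis.
From mathcomp Require Import measurable_realfun ring lra.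

Set Implicit Arguments.
Unset Strict Implicit.
Unset Printing Implicit Defensive.

Import Order.TTheory GRing.Theory Num.Theory.
Import numFieldNormedType.Exports.

Local Open Scope classical_set_scope.
Local Open Scope ring_scope.

(** * Smooth test functions *)

Section test_functions.
Context {R : realType}.
Implicit Types (f g : R -> R) (a b x y : R).

(** The three parts of a summand are less and less integrable, and each is expanded only as far as
    its moments allow. [W = D(xi, t0) / m] has just a second moment, so the second-order remainder
    is kept as [W^2 min(1, |W| / sqrt n)] and not as a cube. [U = x (1 + d2D(xi, t0) / m)], centered
    because [d2D(xi, t0)] has mean [- m], is merely integrable and depends on [W]; it is expanded to
    first order. [C_n] need not be integrable at all when [alpha > 0], since [H] then only has a
    moment of order [q < 1]; the boundedness of the test function alone controls it, whence
    [min(1, |C_n|)]. As [h(s) <= A s^alpha] near 0, [|C_n|] is at most a constant times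
    [H(xi) n^(-1 - alpha/2)], and [q = 2 / (2 + alpha)] is the exponent that turns
    [n^(-1 - alpha/2)] into [1 / n]: this is where the moment condition on [H] comes from. All three
    remainders, multiplied by [n], then have integrable bounds free of [n], so dominated convergence
    does the work of a Lindeberg condition. *)

Lemma mean_value f df a b : (forall x, is_derive x 1 f (df x)) ->
  exists2 c, `|c - a| <= `|b - a| & f b - f a = df c * (b - a).
Proof.
move=> fdf.
have cf (A : set R) : {within A, continuous f}.
  apply: continuous_subspaceT => z; apply: differentiable_continuous.
  by apply/derivable1_diffP; case: (fdf z).
have [ab|ba] := leP a b.
  have [c] := @MVT_segment _ f df a b ab (fun x _ => fdf x) (cf _).
  rewrite in_itv/= => /andP[ac cb] e; exists c => //.
  by rewrite !ger0_norm ?subr_ge0// lerD2r.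
have [c] := @MVT_segment _ f df b a (ltW ba) (fun x _ => fdf x) (cf _).
rewrite in_itv/= => /andP[bc ca] e; exists c.
  by rewrite !ler0_norm ?subr_le0 ?(ltW ba)//; lra.
by rewrite -opprB e; ring.
Qed.

(** A single constant serves all the bounds; [1 <= K] lets it also bound the oscillation of [f],
    whose values lie in [0, 1]. The Lipschitz condition on [f2] stands in for a third derivative. *)
Record test_function (K : R) (f f1 f2 : R -> R) : Prop := TestFunction {
  test_function_itv : forall x, 0 <= f x <= 1;
  test_function_K1 : 1 <= K;
  test_function_derive1 : forall x, is_derive x 1 f (f1 x);
  test_function_derive2 : forall x, is_derive x 1 f1 (f2 x);
  test_function_bound1 : forall x, `|f1 x| <= K;
  test_function_bound2 : forall x, `|f2 x| <= K;
  test_function_lip2 : forall x y, `|f2 y - f2 x| <= K * `|y - x| }.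

Section taylor.
Variables (K : R) (f f1 f2 : R -> R).
Hypothesis tf : test_function K f f1 f2.

Let K1 : 1 <= K. Proof. exact: test_function_K1 tf. Qed.

Let K0 : 0 <= K. Proof. exact: le_trans (test_function_K1 tf). Qed.

Lemma test_function_continuous : continuous f.
Proof.
move=> x; apply: differentiable_continuous; apply/derivable1_diffP.
by case: (test_function_derive1 tf x).
Qed.

Lemma test_function_modulus x y : `|f y - f x| <= K * Num.min 1 `|y - x|.
Proof.
have [h|h] := leP 1 `|y - x|.
  have /andP[? ?] := test_function_itv tf x.
  have /andP[? ?] := test_function_itv tf y.
  by move: K1; rewrite ler_norml => ?; apply/andP; split; lra.
have [c _ ->] := mean_value x y (test_function_derive1 tf).
by rewrite normrM ler_wpM2r// (test_function_bound1 tf).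
Qed.

(** The slope is taken at [x] and not at [x + w]: the term linear in [u] then has a constant
    coefficient and integrates to 0 for a centered [u], even one that depends on [w]. *)
Lemma test_function_taylor1 x w u :
  `|f (x + w + u) - f (x + w) - f1 x * u| <=
  2 * K * (`|u| * Num.min 1 (`|w| + `|u|)).
Proof.
have [c hc ->] := mean_value (x + w) (x + w + u) (test_function_derive1 tf).
rewrite (_ : x + w + u - (x + w) = u) in hc *; last by ring.
rewrite -mulrBl normrM mulrC mulrCA ler_wpM2l//.
have [h|h] := leP 1 (`|w| + `|u|).
  apply: le_trans (ler_normB _ _) _.
  have := test_function_bound1 tf c; have := test_function_bound1 tf x; lra.
have [e _ ->] := mean_value x c (test_function_derive2 tf).
rewrite normrM; apply: ler_pM => //.
  by apply: le_trans (test_function_bound2 tf e) _; move: K0; lra.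
rewrite (_ : c - x = w + (c - (x + w))); last by ring.
by apply: le_trans (ler_normD _ _) _; rewrite lerD2l.
Qed.

(** The mean value theorem, applied to the remainder [g] and then to [f1], leaves an increment of
    [f2]. Boundedness of [f2] controls it for large [w] and the Lipschitz condition for small [w],
    which yields a factor [Num.min 1 |w|] beside [w ^+ 2] and so asks for two moments only. *)
Lemma test_function_taylor2 x w :
  `|f (x + w) - f x - f1 x * w - f2 x * w ^+ 2 / 2| <=
  2 * K * (w ^+ 2 * Num.min 1 `|w|).
Proof.
pose g s := f (x + s) - f x - f1 x * s - f2 x * s ^+ 2 / 2.
pose dg s := f1 (x + s) - f1 x - f2 x * s.
have gdg (s : R) : is_derive s 1 g (dg s).
  have h := test_function_derive1 tf (x + s).
  have h0 : is_derive s 1 (fun t : R => x + t) (1 : R).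
    have -> : (fun t : R => x + t) = cst x + id by [].
    by apply: is_derive_eq; rewrite add0r.
  have h1 := @is_derive1_comp _ f (fun t => x + t) s _ _ h h0.
  have -> : g = ((f \o (fun t : R => x + t)) - cst (f x)) - (f1 x \*: id)
      - ((f2 x / 2) \*: (id ^+ 2)).
    by apply/funext => t; rewrite /g !fctE/= /GRing.scale/=; ring.
  by apply: is_derive_eq; rewrite /dg /GRing.scale/=; field.

have [c hc] := mean_value 0 w gdg.
rewrite /g !addr0 !mulr0 expr0n/= mulr0 mul0r !subr0 subrr subr0 in hc *.
move=> ->; rewrite normrM.
have [e he] := mean_value x (x + c) (test_function_derive2 tf).
rewrite (_ : x + c - x = c) in he *; last by ring.
rewrite /dg => ->.
have A : `|f2 e - f2 x| <= 2 * K * Num.min 1 `|w|.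
  have [h|h] := leP 1 `|w|.
    apply: le_trans (ler_normB _ _) _.
    have := test_function_bound2 tf e; have := test_function_bound2 tf x; lra.
  apply: le_trans (test_function_lip2 tf _ _) _.
  have : K * `|e - x| <= K * `|w| by rewrite ler_wpM2l// (le_trans he).
  by have : 0 <= K * `|w| by [exact: mulr_ge0]; lra.
rewrite -mulrBl normrM.
apply: (@le_trans _ _ (2 * K * Num.min 1 `|w| * `|w| * `|w|)).
  by rewrite ler_wpM2r// ler_pM.
by rewrite -mulrA -expr2 real_normK ?num_real// -mulrA (mulrC (w ^+ 2)).
Qed.

Lemma test_function_expansion x w u c :
  `|f (x + w + u + c) - f x - f1 x * (w + u) - f2 x * w ^+ 2 / 2| <=
  2 * K * (Num.min 1 `|c| + `|u| * Num.min 1 (`|w| + `|u|)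
           + w ^+ 2 * Num.min 1 `|w|).
Proof.
have h1 := test_function_modulus (x + w + u) (x + w + u + c).
rewrite (_ : x + w + u + c - (x + w + u) = c) in h1; last by ring.
have h2 := test_function_taylor1 x w u.
have h3 := test_function_taylor2 x w.
rewrite (_ : _ - _ = (f (x + w + u + c) - f (x + w + u)) +
  (f (x + w + u) - f (x + w) - f1 x * u) +
  (f (x + w) - f x - f1 x * w - f2 x * w ^+ 2 / 2)); last by ring.
apply: le_trans (ler_normD _ _) _; rewrite !mulrDr; apply: lerD => //.
apply: le_trans (ler_normD _ _) _; apply: lerD => //.
apply: le_trans h1 _; rewrite ler_wpM2r// ?le_min ?ler01/=//.
by have := K0; lra.
Qed.
End taylor.

End test_functions.

(** * Logistic functions as smoothed indicators of half-lines *)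

Section logistic.
Context {R : realType}.
Variable l : R.
Hypothesis l0 : 0 < l.

(** A decreasing function close to the indicator of the negative half-line when [l] is large. It
    solves [y' = - l y (1 - y)], so its derivatives are polynomials in itself and therefore
    bounded. *)
Definition logistic (x : R) : R := (1 + expR (l * x))^-1.

Let dlogistic (x : R) : R := - l * (logistic x * (1 - logistic x)).
Let d2logistic (x : R) : R := - l * (dlogistic x * (1 - 2 * logistic x)).
Let d3logistic (x : R) : R :=
  - l * (d2logistic x * (1 - 2 * logistic x) - 2 * dlogistic x ^+ 2).

Lemma logistic_itv x : 0 <= logistic x <= 1.
Proof.
have e0 := expR_gt0 (l * x).
rewrite /logistic invr_ge0 invf_le1; last by lra.
by apply/andP; split; lra.
Qed.

Let is_derive_logistic (x : R) : is_derive x 1 logistic (dlogistic x).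
Proof.
have e0 := expR_gt0 (l * x).
have n0 : 1 + expR (l * x) != 0 by rewrite gt_eqF//; lra.
have h0 : is_derive x 1 (fun t : R => l * t) l.
  have -> : (fun t : R => l * t) = l \*: id by [].
  by apply: is_derive_eq; rewrite /GRing.scale/= mulr1.
have h1 := @is_derive1_comp _ expR (fun t : R => l * t) x _ _ (is_derive_expR _) h0.
have h2 : is_derive x 1 (fun t : R => 1 + expR (l * t)) (expR (l * x) * l).
  have -> : (fun t => 1 + expR (l * t)) = cst 1 + (expR \o (fun t : R => l * t)) by [].
  by apply: is_derive_eq; rewrite add0r.
have := @is_deriveV _ (fun t : R => 1 + expR (l * t)) x _ 1 n0 h2.
rewrite /dlogistic /logistic => h3.
apply: is_derive_eq; rewrite /GRing.scale/=; field.
exact: n0.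
Qed.

Let is_derive_dlogistic (x : R) : is_derive x 1 dlogistic (d2logistic x).
Proof.
have h := is_derive_logistic x.
have -> : dlogistic = (- l) \*: (logistic * (cst 1 - logistic)) by [].
apply: is_derive_eq.
by rewrite /d2logistic /dlogistic /GRing.scale/= !fctE; ring.
Qed.

Let is_derive_d2logistic (x : R) : is_derive x 1 d2logistic (d3logistic x).
Proof.
have h := is_derive_logistic x; have h' := is_derive_dlogistic x.
have -> : d2logistic = (- l) \*: (dlogistic * (cst 1 - cst 2 * logistic)) by [].
apply: is_derive_eq.
by rewrite /d3logistic /d2logistic /dlogistic !fctE /GRing.scale/=; ring.
Qed.

Let ler_normM1 (a b c : R) : `|a| <= c -> `|b| <= 1 -> `|a * b| <= c.
Proof. by move=> ac b1; rewrite normrM -[c]mulr1 ler_pM. Qed.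

Let norm_1B2logistic x : `|1 - 2 * logistic x| <= 1.
Proof.
have /andP[? ?] := logistic_itv x.
by rewrite ler_norml; apply/andP; split; lra.
Qed.

Let norm_dlogistic x : `|dlogistic x| <= l.
Proof.
apply: ler_normM1; first by rewrite normrN gtr0_norm.
have /andP[? ?] := logistic_itv x.
by apply: ler_normM1; rewrite ler_norml; apply/andP; split; lra.
Qed.

Let norm_d2logistic x : `|d2logistic x| <= l ^+ 2.
Proof.
rewrite /d2logistic mulrA; apply: ler_normM1 => //.
by rewrite normrM normrN (gtr0_norm l0) expr2 ler_pM2l.
Qed.

Let norm_d3logistic x : `|d3logistic x| <= 3 * l ^+ 3.
Proof.
rewrite /d3logistic normrM normrN (gtr0_norm l0).
have h : `|d2logistic x * (1 - 2 * logistic x)| <= l ^+ 2 by exact: ler_normM1.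
have h' : `|2 * dlogistic x ^+ 2| <= 2 * l ^+ 2.
  by rewrite normrM ger0_norm// ler_wpM2l// normrX lerXn2r// nnegrE ltW.
rewrite (_ : 3 * l ^+ 3 = l * (l ^+ 2 + 2 * l ^+ 2)); last by ring.
rewrite ler_pM2l//; apply: le_trans (ler_normB _ _) _; exact: lerD.
Qed.

Lemma test_function_logistic : exists K f1 f2, test_function K logistic f1 f2.
Proof.
have l2 : 0 <= l ^+ 2 by rewrite exprn_ge0// ltW.
have l3 : 0 <= l ^+ 3 by rewrite exprn_ge0// ltW.
exists (1 + l + l ^+ 2 + 3 * l ^+ 3), dlogistic, d2logistic; split => //.
- exact: logistic_itv.
- by move: l0; lra.
- by move=> x; have := norm_dlogistic x; move: l0; lra.
- by move=> x; have := norm_d2logistic x; move: l0; lra.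
- move=> x y; have [c _ ->] := mean_value x y is_derive_d2logistic.
  rewrite normrM ler_wpM2r//; have := norm_d3logistic c; move: l0; lra.
Qed.

End logistic.

(** With [l = eta^-1 / e], [1 + expR (l * x) >= l * x >= eta^-1] as soon as [x >= e]. The left tail
    follows from the symmetry [logistic l (- x) = 1 - logistic l x]. *)
Lemma logistic_step {R : realType} (e eta : R) : 0 < e -> 0 < eta ->
  exists2 l, 0 < l & (forall x, x <= - e -> 1 - eta <= logistic l x) /\
                     (forall x, e <= x -> logistic l x <= eta).
Proof.
move=> e0 eta0; exists (eta^-1 / e); first by rewrite divr_gt0// invr_gt0.
have le : forall x, e <= x -> logistic (eta^-1 / e) x <= eta.
  move=> x ex; rewrite /logistic -[leRHS]invrK.
  have h : eta^-1 <= eta^-1 / e * x.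
    by rewrite -mulrA ler_peMr ?invr_ge0 ?(ltW eta0)// mulrC ler_pdivlMr// mul1r.
  have h' := expR_ge1Dx (eta^-1 / e * x).
  have i0 : 0 < eta^-1 by rewrite invr_gt0.
  by rewrite lef_pV2 ?posrE//; lra.
split=> // x xe.
have : logistic (eta^-1 / e) (- x) <= eta by apply: le; lra.
rewrite /logistic mulrN expRN.
have := expR_gt0 (eta^-1 / e * x); set a := expR _ => a0.
have -> : (1 + a^-1)^-1 = 1 - (1 + a)^-1.
  by field; rewrite !gt_eqF//; lra.
lra.
Qed.

(** * Averaging operators *)

Section average.
Context {R : realType}.

(** This class is stable under averaging; its members are integrable for every probability and
    nonnegative, so that Tonelli's theorem always applies. *)
Definition unit_fun (f : R -> R) :=
  measurable_fun setT f /\ forall x, 0 <= f x <= 1.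

Lemma bounded_integrable d (T : measurableType d) (P : probability T R)
    (g : T -> R) (C : R) : measurable_fun setT g -> (forall w, `|g w| <= C) ->
  P.-integrable setT (EFin \o g).
Proof.
move=> mg gC; apply: measurable_bounded_integrable => //.
  exact: fin_num_fun_lty.
exists C; split; first exact: num_real.
by move=> M CM w _ /=; exact: le_trans (gC w) (ltW CM).
Qed.

Definition avg d (T : measurableType d) (P : probability T R) (X : T -> R)
  (f : R -> R) (y : R) : R := (\int[P]_w f (y + X w))%R.

Section avg.
Context d (T : measurableType d) (P : probability T R) (X : T -> R).
Hypothesis mX : measurable_fun setT X.

Lemma measurable_unit_fun f y : unit_fun f ->
  measurable_fun setT (fun w => f (y + X w)).
Proof. by move=> [mf _]; apply: measurableT_comp => //; exact: measurable_funD. Qed.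

Lemma integrable_unit_fun f y : unit_fun f ->
  P.-integrable setT (EFin \o (fun w => f (y + X w))).
Proof.
move=> uf; apply: (@bounded_integrable _ _ _ _ 1); first exact: measurable_unit_fun.
by move=> w; have /andP[? ?] := uf.2 (y + X w); rewrite ger0_norm.
Qed.

Lemma avgE f y : unit_fun f ->
  (avg P X f y)%:E = (\int[P]_w (f (y + X w))%:E)%E.
Proof.
move=> uf; rewrite /avg /Rintegral fineK//.
exact: (integrable_fin_num _ (integrable_unit_fun y uf)).
Qed.

Lemma avg_le f g y (d0 : R) : unit_fun f -> unit_fun g ->
  (forall x, `|f x - g x| <= d0) -> `|avg P X f y - avg P X g y| <= d0.
Proof.
move=> uf ug fg.
have If := integrable_unit_fun y uf; have Ig := integrable_unit_fun y ug.
have IB : P.-integrable setT (EFin \o (fun w => f (y + X w) - g (y + X w))).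
  by apply: eq_integrable (integrableB _ If Ig).
rewrite /avg -RintegralB//.
apply: le_trans (le_normr_Rintegral _ _) _ => //.
rewrite (_ : d0 = \int[P]_(w in setT) d0)%R; last first.
  by rewrite Rintegral_cst// [X in fine X]probability_setT mulr1.
apply: le_Rintegral => //.
- exact: integrable_norm.
- exact: finite_measure_integrable_cst.
Qed.

Lemma unit_fun_avg f : unit_fun f -> unit_fun (avg P X f).
Proof.
move=> uf; split.
  apply/measurable_EFinP; rewrite (_ : _ \o _ =
    fun y => (\int[P]_w (f (y + X w))%:E)%E); last first.
    by apply/funext => y /=; rewrite avgE.
  apply: (@measurable_fun_fubini_tonelli_F _ _ (measurableTypeR R) T R P
    (fun p : (measurableTypeR R) * T => (f (p.1 + X p.2))%:E)).
    apply/measurable_EFinP; apply: measurableT_comp; first exact: uf.1.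
    by apply: measurable_funD => //; exact: measurableT_comp.
  by move=> p; rewrite lee_fin; case/andP: (uf.2 (p.1 + X p.2)).
move=> y; rewrite -!lee_fin avgE//; apply/andP; split.
  by apply: integral_ge0 => w _; rewrite lee_fin; case/andP: (uf.2 (y + X w)).
rewrite -(probability_setT P) -[leRHS]mul1e -integral_cst//.
apply: ge0_le_integral => //.
- by move=> w _; rewrite lee_fin; case/andP: (uf.2 (y + X w)).
- by apply/measurable_EFinP; exact: measurable_unit_fun.
- by move=> w _; rewrite lee_fin; case/andP: (uf.2 (y + X w)).
Qed.

End avg.

(** Tonelli's theorem and the commutativity of addition. The two variables live on separate spaces,
    so that no normal variable has to be built next to the sample. *)
Lemma avg_avgC d1 (T1 : measurableType d1) (P1 : probability T1 R)
    d2 (T2 : measurableType d2) (P2 : probability T2 R) X1 X2 f :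
  measurable_fun setT X1 -> measurable_fun setT X2 -> unit_fun f ->
  avg P1 X1 (avg P2 X2 f) = avg P2 X2 (avg P1 X1 f).
Proof.
move=> m1 m2 uf; apply/funext => y; apply: EFin_inj.
rewrite !avgE//; [|exact: unit_fun_avg..].
under eq_integral do rewrite avgE//.
under [RHS]eq_integral do rewrite avgE//.
rewrite (fubini_tonelli (fun p => (f (y + X1 p.1 + X2 p.2))%:E)); last 2 first.
- apply/measurable_EFinP; apply: measurableT_comp; first exact: uf.1.
  by apply: measurable_funD; [apply: measurable_funD => //|]; exact: measurableT_comp.
- by move=> p; rewrite lee_fin; case/andP: (uf.2 (y + X1 p.1 + X2 p.2)).
by apply: eq_integral => w _; apply: eq_integral => w' _; rewrite addrAC.
Qed.

End average.

(** * Expansion of one summand up to o(1/n) *)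

Lemma cvg_invn {R : realType} : (n%:R)^-1 @[n --> \oo] --> (0 : R).
Proof. by rewrite -cvg_shiftS; exact: cvg_harmonic. Qed.

Lemma cvg_invsqrtn {R : realType} : (Num.sqrt n%:R)^-1 @[n --> \oo] --> (0 : R).
Proof.
have h : Num.sqrt (n%:R^-1) @[n --> \oo] --> Num.sqrt (0 : R).
  by apply: continuous_cvg; [exact: sqrt_continuous|exact: cvg_invn].
rewrite sqrtr0 in h; apply: cvg_trans h; apply: near_eq_cvg; apply: nearW => n.
by rewrite sqrtrV.
Qed.

Section expansion.
Context {R : realType} d (T : measurableType d) (P : probability T R).
Variables (W U G : T -> R) (C : nat -> T -> R) (v : R).
Hypotheses (mW : measurable_fun setT W) (mU : measurable_fun setT U)
  (mC : forall n, measurable_fun setT (C n)).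
Hypotheses (iW2 : P.-integrable setT (EFin \o (fun w => W w ^+ 2)))
  (iU : P.-integrable setT (EFin \o U)) (iG : P.-integrable setT (EFin \o G)).
Hypotheses (W0 : (\int[P]_w W w = 0)%R) (W2 : (\int[P]_w W w ^+ 2 = v)%R)
  (U0 : (\int[P]_w U w = 0)%R).
Hypotheses (CG : forall n w, n%:R * Num.min 1 `|C n w| <= G w)
  (C0 : forall w, n%:R * Num.min 1 `|C n w| @[n --> \oo] --> (0 : R)).

Let X n w := W w / Num.sqrt n%:R + U w / n%:R + C n w.

(** This is [n] times the bound of [test_function_expansion], without its factor [2 * K]. The base
    point does not occur in it, which makes the final rate uniform. *)
Let err n w := n%:R * Num.min 1 `|C n w| +
  `|U w| * Num.min 1 (`|W w / Num.sqrt n%:R| + `|U w / n%:R|) +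
  W w ^+ 2 * Num.min 1 `|W w / Num.sqrt n%:R|.

Let dom w := G w + `|U w| + W w ^+ 2.

Let min1_ge0 (x : R) : 0 <= x -> 0 <= Num.min 1 x.
Proof. by move=> x0; rewrite le_min ler01. Qed.

Let min1_le1 (x : R) : Num.min 1 x <= 1.
Proof. by rewrite ge_min lexx. Qed.

Let err_ge0 n w : 0 <= err n w.
Proof. by rewrite !addr_ge0// mulr_ge0 ?sqr_ge0 ?min1_ge0// addr_ge0. Qed.

Let err_dom n w : err n w <= dom w.
Proof.
apply: lerD; last by rewrite ler_piMr ?sqr_ge0.
by apply: lerD; rewrite ?CG// ler_piMr.
Qed.

Let err_cvg w : err n w @[n --> \oo] --> (0 : R).
Proof.
have hW : `|W w / Num.sqrt n%:R| @[n --> \oo] --> (0 : R).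
  rewrite -(normr0 R) -(mulr0 (W w)).
  by apply: cvg_norm; apply: cvgMl_tmp; exact: cvg_invsqrtn.
have hU : `|U w / n%:R| @[n --> \oo] --> (0 : R).
  rewrite -(normr0 R) -(mulr0 (U w)); apply: cvg_norm; apply: cvgMl_tmp.
  exact: cvg_invn.
have m (a : nat -> R) : (forall n, 0 <= a n) -> a @ \oo --> (0 : R) ->
    Num.min 1 (a n) @[n --> \oo] --> (0 : R).
  move=> a0 ha; apply: (@squeeze_cvgr _ _ _ _ (cst 0) a) => //.
    by apply: nearW => n; rewrite min1_ge0//= ge_min lexx orbT.
  exact: cvg_cst.
rewrite (_ : 0 = 0 + `|U w| * 0 + W w ^+ 2 * 0); last by ring.
apply: cvgD; first apply: cvgD => //.
- apply: cvgMl_tmp; apply: m => [n|]; first exact: addr_ge0.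
  by rewrite -(addr0 0); exact: cvgD.
- by apply: cvgMl_tmp; exact: m.
Qed.

Let measurable_min1 (g : T -> R) : measurable_fun setT g ->
  measurable_fun setT (fun w => Num.min 1 `|g w|).
Proof. by move=> mg; apply: measurable_minr => //; exact: measurableT_comp. Qed.

Let measurable_err n : measurable_fun setT (err n).
Proof.
have mW' : measurable_fun setT (fun w => W w / Num.sqrt n%:R).
  exact: measurable_funM.
have mU' : measurable_fun setT (fun w => U w / n%:R) by exact: measurable_funM.
apply: measurable_funD; last first.
  by apply: measurable_funM; [exact: measurable_funX|exact: measurable_min1].
apply: measurable_funD.
  by apply: measurable_funM => //; exact: measurable_min1.
apply: measurable_funM; first exact: measurableT_comp.
by apply: measurable_minr => //; apply: measurable_funD; exact: measurableT_comp.
Qed.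

Let measurable_X n : measurable_fun setT (X n).
Proof.
by apply: measurable_funD => //; apply: measurable_funD; exact: measurable_funM.
Qed.

Let idom : P.-integrable setT (EFin \o dom).
Proof.
have iUn := integrable_norm iU.
by apply: eq_integrable (integrableD _ (integrableD _ iG iUn) iW2).
Qed.

Let ierr n : P.-integrable setT (EFin \o err n).
Proof.
apply: le_integrable idom => //; first exact/measurable_EFinP.
move=> w _ /=; rewrite lee_fin !ger0_norm//.
by apply: le_trans (err_dom n w).
Qed.

Let iW : P.-integrable setT (EFin \o W).
Proof.
have i1 : P.-integrable setT (EFin \o (fun w => 1 + W w ^+ 2)).
  apply: eq_integrable (integrableD _ (finite_measure_integrable_cst P 1 _) iW2) => //.
apply: le_integrable i1 => //; first exact/measurable_EFinP.
move=> w _ /=; rewrite lee_fin [leRHS]ger0_norm ?addr_ge0 ?sqr_ge0//.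
have := sqr_ge0 (1 - `|W w|); rewrite sqrrB real_normK ?num_real// => h.
by have := normr_ge0 (W w); lra.
Qed.

Let Rierr_cvg : (\int[P]_w err n w)%R @[n --> \oo] --> (0 : R).
Proof.
have [|||||_ _] := @dominated_convergence _ _ _ P setT measurableT
  (fun n => EFin \o err n) (cst 0%E) (EFin \o dom).
- by move=> n; exact/measurable_EFinP.
- by [].
- by apply: aeW => w _; apply: cvg_EFin; [exact: nearW|exact: err_cvg].
- exact: idom.
- by apply: aeW => w n _; rewrite /= lee_fin ger0_norm.
rewrite integral0 => h.
exact: (fine_cvg h).
Qed.

(** Integration kills the terms in [f1], as [W] and [U] are centered, and turns the term in [f2]
    into [v / (2 n) * f2 y]. What remains is at most [2 * K / n] times the integral of [err n],
    which vanishes by dominated convergence. *)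
Lemma avg_expansion K f f1 f2 : test_function K f f1 f2 ->
  exists2 e : nat -> R, e @ \oo --> (0 : R) &
  forall n y, (0 < n)%N ->
    `|avg P (X n) f y - f y - v / (2 * n%:R) * f2 y| <= e n / n%:R.
Proof.
move=> tf; exists (fun n => 2 * K * \int[P]_w err n w)%R.
  by rewrite -(mulr0 (2 * K)); exact: cvgMl_tmp.
move=> n y n0; have nR : (0 : R) < n%:R by rewrite ltr0n.
have uf : unit_fun f.
  split; last exact: test_function_itv tf.
  by apply: continuous_measurable_fun; exact: test_function_continuous tf.
pose s : R := Num.sqrt n%:R.
have s2 : s ^+ 2 = n%:R by rewrite sqr_sqrtr.
have s0 : 0 < s by rewrite sqrtr_gt0.
pose g w := f (y + X n w) - (f y + f1 y / s * W w + f1 y / n%:R * U w +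
  f2 y / (2 * n%:R) * W w ^+ 2).
have iA := integrable_unit_fun P (measurable_X n) y uf.
have i1 : P.-integrable setT (EFin \o (fun=> f y)).
  exact: finite_measure_integrable_cst.
have iZ (a : R) (h : T -> R) : P.-integrable setT (EFin \o h) ->
    P.-integrable setT (EFin \o (fun w => a * h w)).
  by move=> ih; apply: eq_integrable (integrableZl _ a ih).
have iD (h k : T -> R) : P.-integrable setT (EFin \o h) ->
    P.-integrable setT (EFin \o k) ->
    P.-integrable setT (EFin \o (fun w => h w + k w)).
  by move=> ih ik; apply: eq_integrable (integrableD _ ih ik).
have iW' := iZ (f1 y / s) _ iW; have iU' := iZ (f1 y / n%:R) _ iU.
have iW2' := iZ (f2 y / (2 * n%:R)) _ iW2.
have i2 := iD _ _ i1 iW'; have i3 := iD _ _ i2 iU'; have i4 := iD _ _ i3 iW2'.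
have ig : P.-integrable setT (EFin \o g).
  by apply: eq_integrable (integrableB _ iA i4).
have -> : avg P (X n) f y - f y - v / (2 * n%:R) * f2 y = (\int[P]_w g w)%R.
  rewrite /g RintegralB// RintegralD// RintegralD// RintegralD// !RintegralZl//.
  rewrite W0 W2 U0 !mulr0 !addr0 Rintegral_cst//.
  rewrite [X in f y * fine X]probability_setT mulr1 /avg.
  by field; rewrite gt_eqF.
apply: le_trans (le_normr_Rintegral _ ig) _ => //.
rewrite mulrAC -RintegralZl//.
apply: le_Rintegral => //; [exact: integrable_norm|exact: iZ|].
move=> w _.
have := test_function_expansion tf y (W w / s) (U w / n%:R) (C n w).
have -> : y + W w / s + U w / n%:R + C n w = y + X n w.
  by rewrite /X !addrA.
have -> : f (y + X n w) - f y - f1 y * (W w / s + U w / n%:R) -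
   f2 y * (W w / s) ^+ 2 / 2 = g w.
  rewrite /g expr_div_n s2; field.
  by rewrite !gt_eqF.
have K0 : 0 <= K by exact: le_trans (test_function_K1 tf).
move=> h; apply: le_trans h _; rewrite -(mulrA (2 * K)) ler_wpM2l ?mulr_ge0//.
rewrite /err -/s expr_div_n s2 normrM (gtr0_norm (_ : 0 < n%:R^-1)) ?invr_gt0//.
rewrite le_eqVlt; apply/orP; left; apply/eqP; field.
by rewrite gt_eqF.
Qed.

End expansion.

(** * The normal law *)

Section normal.
Context {R : realType}.
Implicit Types (s t x y z : R) (f : R -> R).
Local Notation mu := (@lebesgue_measure R).
Local Notation N s := (normal_prob (0 : R) s).

(** The Radon-Nikodym derivative of the normal law agrees almost everywhere with the density, both
    having the same integral over every measurable set. *)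
Lemma ge0_integral_normal_prob s (g : R -> \bar R) : measurable_fun setT g ->
  (forall x, 0 <= g x)%E ->
  (\int[N s]_x g x = \int[mu]_x (g x * (normal_pdf 0 s x)%:E))%E.
Proof.
move=> mg g0.
have dom := normal_prob_dominates 0 s.
rewrite -(Radon_Nikodym_SigmaFinite.change_of_variables dom g0 measurableT mg).
apply: ae_eq_integral => //.
- apply: emeasurable_funM => //.
  exact: measurable_int (Radon_Nikodym_SigmaFinite.f_integrable dom).
- by apply: emeasurable_funM => //; apply/measurable_EFinP; exact: measurable_normal_pdf.
apply: ae_eqe_mul2l; apply: integral_ae_eq => //.
- exact: Radon_Nikodym_SigmaFinite.f_integrable.
- by apply/measurable_EFinP; exact: measurable_normal_pdf.
- by move=> E _ mE; rewrite -Radon_Nikodym_SigmaFinite.f_integral.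
Qed.

Lemma ge0_integral_affine (a b : R) (G : R -> R) : 0 < a ->
  continuous G -> (forall x, 0 <= G x) ->
  (\int[mu]_x (G x)%:E = \int[mu]_x (G (a * x + b) * a)%:E)%E.
Proof.
move=> a0 cG G0; pose F x := a * x + b.
have dF x : is_derive x 1 F a.
  have -> : F = (a \*: id) + cst b by [].
  by apply: is_derive_eq; rewrite addr0 /GRing.scale/= mulr1.
have F' : F^`()%classic = cst a.
  by apply/funext => x; rewrite derive1E; case: (dF x).
rewrite (@increasing_ge0_integration_by_substitutionT _ F G)//.
- by rewrite F'.
- by move=> x z xz; rewrite /F ltrD2r ltr_pM2l.
- by rewrite F' => x; exact: cvg_cst.
- by rewrite F'; exact: is_cvg_cst.
- by rewrite F'; exact: is_cvg_cst.
- apply: (cvg_comp _ (fun x => x + b)); last exact: cvg_addrr_Ny.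
  exact: gt0_cvgMrNy.
- apply: (cvg_comp _ (fun x => x + b)); last exact: cvg_addrr.
  exact: gt0_cvgMry.
Qed.

Lemma normal_pdf_scale s z : 0 < s -> normal_pdf 0 s (s * z) * s = normal_pdf 0 1 z.
Proof.
move=> s0; rewrite !normal_pdfE ?gt_eqF// /normal_peak /normal_fun !subr0 expr1n mul1r.
rewrite exprMn -(mulrnAr _ pi) sqrtrM ?sqr_ge0// sqrtr_sqr gtr0_norm// invfM.
rewrite mulrAC (mulrC s^-1) -(mulrA _ s^-1) mulVf ?gt_eqF// mulr1.
congr (_ * expR _); field.
by rewrite gt_eqF.
Qed.

Let continuous_shift f y : continuous f -> continuous (fun x => f (y + x)).
Proof.
move=> cf x; apply: (@continuous_comp _ _ _ (fun x => y + x) f); last exact: cf.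
by apply: cvgD; [exact: cvg_cst|exact: cvg_id].
Qed.

Lemma avg_normalE s f y : unit_fun f -> ((avg (N s) idfun f y)%:E =
  \int[mu]_x (f (y + x)%R * normal_pdf 0 s x)%:E)%E.
Proof.
move=> uf; rewrite avgE//; last exact: measurable_id.
have := @ge0_integral_normal_prob s (fun x => (f (y + x))%:E).
apply.
- by apply/measurable_EFinP; exact: measurable_unit_fun.
- by move=> x; rewrite lee_fin; case/andP: (uf.2 (y + x)).
Qed.

(** The standard normal law thus carries the comparison variables of all rows at once, as multiples
    of one [z]. *)
Lemma avg_normal_scale s f y : 0 < s -> continuous f -> unit_fun f ->
  avg (N 1) (fun z => s * z) f y = avg (N s) idfun f y.
Proof.
move=> s0 cf uf; apply: EFin_inj.
have ms : measurable_fun setT (fun z : R => s * z) by exact: measurable_funM.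
etransitivity; first exact: (avgE (N 1) ms y uf).
etransitivity; last exact: (esym (avg_normalE s y uf)).
have h := @ge0_integral_normal_prob 1 (fun x => (f (y + s * x))%:E).
etransitivity.
  apply: h; first by apply/measurable_EFinP; exact: measurable_unit_fun.
  by move=> x; rewrite lee_fin; case/andP: (uf.2 (y + s * x)).
rewrite [RHS](@ge0_integral_affine s 0)//.
- by apply: eq_integral => z _; rewrite addr0 -mulrA normal_pdf_scale.
- move=> x; apply: cvgM; first exact: continuous_shift.
  by apply: continuous_normal_pdf; rewrite gt_eqF.
- by move=> x; rewrite mulr_ge0 ?normal_pdf_ge0//; case/andP: (uf.2 (y + x)).
Qed.

(* Completing the square in z. *)
Lemma normal_pdf_convolution s t x z : 0 < s -> 0 < t ->
  let u := Num.sqrt (s ^+ 2 + t ^+ 2) in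
  normal_pdf 0 s z * normal_pdf 0 t (x - z) =
  normal_pdf 0 u x * normal_pdf (x * s ^+ 2 / u ^+ 2) (s * t / u) z.
Proof.
move=> s0 t0 u.
have u2 : u ^+ 2 = s ^+ 2 + t ^+ 2 by rewrite sqr_sqrtr// addr_ge0 ?sqr_ge0.
have uu0 : 0 < s ^+ 2 + t ^+ 2 by rewrite addr_gt0// exprn_gt0.
have u0 : 0 < u by rewrite sqrtr_gt0.
have v0 : 0 < s * t / u by rewrite divr_gt0// mulr_gt0.
rewrite !normal_pdfE ?gt_eqF// mulrACA [RHS]mulrACA; congr (_ * _).
  rewrite /normal_peak.
  have p w : 0 < w -> (Num.sqrt (w ^+ 2 * pi *+ 2))^-1 = w^-1 * (Num.sqrt (pi *+ 2))^-1.
    by move=> w0; rewrite -mulrnAr sqrtrM ?sqr_ge0// sqrtr_sqr gtr0_norm// invfM.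
  rewrite !p//.
  have pp : Num.sqrt (pi *+ 2 : R) != 0.
    by rewrite gt_eqF// sqrtr_gt0 pmulrn_lgt0// pi_gt0.
  by field; rewrite pp !gt_eqF.
rewrite /normal_fun -!expRD; congr expR.
rewrite expr_div_n u2; field.
by rewrite !gt_eqF// u2.
Qed.

(** After a translation of the inner variable and an exchange of integrals, completing the square
    leaves in [z] a normal density, of total mass 1. *)
Lemma avg_normal_convolution s t f : 0 < s -> 0 < t -> continuous f -> unit_fun f ->
  avg (N s) idfun (avg (N t) idfun f) =
  avg (N (Num.sqrt (s ^+ 2 + t ^+ 2))) idfun f.
Proof.
move=> s0 t0 cf uf; apply/funext => y; apply: EFin_inj.
have f0 x : 0 <= f x by case/andP: (uf.2 x).
have uft : unit_fun (avg (N t) idfun f).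
  by apply: unit_fun_avg => //; exact: measurable_id.
etransitivity; first exact: (avg_normalE s y uft).
etransitivity; last exact: (esym (avg_normalE _ y uf)).
under eq_integral => z _.
  rewrite mulrC EFinM (avg_normalE t (y + z) uf); over.
pose h (p : measurableTypeR R * measurableTypeR R) : \bar R :=
  (f (y + p.2) * (normal_pdf 0 s p.1 * normal_pdf 0 t (p.2 - p.1)))%:E.
transitivity (\int[mu]_z \int[mu]_x h (z, x))%E.
  apply: eq_integral => z _.
  rewrite [X in (_ * X)%E](@ge0_integral_affine 1 (- z))//; last 2 first.
  - move=> x; apply: cvgM; first exact: continuous_shift.
    by apply: continuous_normal_pdf; rewrite gt_eqF.
  - by move=> x; rewrite mulr_ge0 ?normal_pdf_ge0.
  rewrite -ge0_integralZl//; last 3 first.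
  - apply/measurable_EFinP; apply: measurable_funM => //.
    have ma : measurable_fun setT (fun x : R => 1 * x - z).
      by apply: measurable_funD => //; exact: measurable_funM.
    apply: measurable_funM; apply: measurableT_comp => //; last first.
    + exact: measurable_normal_pdf.
    + by apply: measurable_funD.
    + exact: uf.1.
  - by move=> x _; rewrite lee_fin mulr1 mulr_ge0 ?normal_pdf_ge0.
  - by rewrite lee_fin normal_pdf_ge0.
  apply: eq_integral => x _; rewrite /h/= -EFinM; congr (_%:E).
  rewrite mul1r mulr1 mulrCA; congr (f _ * _); ring.
rewrite (fubini_tonelli h); last 2 first.
- apply/measurable_EFinP; apply: measurable_funM.
    apply: measurableT_comp; first exact: uf.1.
    by apply: measurable_funD => //; exact: measurable_snd.
  apply: measurable_funM; apply: measurableT_comp; try exact: measurable_normal_pdf.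
    exact: measurable_fst.
  by apply: measurable_funB; [exact: measurable_snd|exact: measurable_fst].
- by move=> p; rewrite lee_fin !mulr_ge0 ?normal_pdf_ge0.
apply: eq_integral => x _.
rewrite /h/=.
under eq_integral do rewrite normal_pdf_convolution// mulrA EFinM.
rewrite ge0_integralZl//; last 3 first.
- by apply/measurable_EFinP; exact: measurable_normal_pdf.
- by move=> z _; rewrite lee_fin normal_pdf_ge0.
- by rewrite lee_fin mulr_ge0 ?normal_pdf_ge0.
by rewrite integral_normal_pdf mule1.
Qed.

Local Notation phi := (normal_pdf (0 : R) 1).

Let phi_ge0 x : 0 <= phi x. Proof. exact: normal_pdf_ge0. Qed.

Let mphi : measurable_fun setT phi. Proof. exact: measurable_normal_pdf. Qed.

Let cphi : continuous phi. Proof. by apply: continuous_normal_pdf; exact: oner_neq0. Qed.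

Let phiE x : phi x = normal_peak 1 * expR (- (x ^+ 2 / 2)).
Proof.
by rewrite normal_pdfE ?oner_neq0// /normal_fun subr0 expr1n mulNr.
Qed.

Let phiN x : phi (- x) = phi x. Proof. by rewrite !phiE sqrrN. Qed.

Let is_derive_phi (x : R) : is_derive x 1 phi (- (x * phi x)).
Proof.
have h : is_derive x 1 (fun z : R => - (z ^+ 2 / 2)) (- x).
  have -> : (fun z : R => - (z ^+ 2 / 2)) = (- (2^-1)) \*: (id ^+ 2).
    by apply/funext => z; rewrite /= exprfctE /GRing.scale/=; ring.
  by apply: is_derive_eq; rewrite /GRing.scale/=; field.
have h1 := @is_derive1_comp _ expR _ x _ _ (is_derive_expR _) h.
have -> : phi = normal_peak 1 \*: (expR \o (fun z : R => - (z ^+ 2 / 2))).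
  by apply/funext => z; rewrite phiE.
by apply: is_derive_eq; rewrite /= /GRing.scale/=; ring.
Qed.

Let xphi (x : R) := x * phi x.

Let is_derive_xphi (x : R) : is_derive x 1 xphi ((1 - x ^+ 2) * phi x).
Proof.
have h := is_derive_phi x.
have -> : xphi = id * phi by [].
by apply: is_derive_eq; rewrite /GRing.scale/=; ring.
Qed.

Let xphi_cvg0 : xphi x @[x --> +oo] --> (0 : R).
Proof.
have h : (2 * normal_peak (1 : R)) * x^-1 @[x --> +oo] --> (0 : R).
  rewrite -(mulr0 (2 * normal_peak 1)); apply: cvgMl_tmp.
  by apply/(@gtr0_cvgV0 _ _ _ _ id); [exact: nbhs_pinfty_gt|exact: cvg_id].
(* The upper bound comes from [expR (x ^+ 2 / 2) >= x ^+ 2 / 2]. *)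
apply: (@squeeze_cvgr _ _ _ _ (cst 0)
  (fun x => (2 * normal_peak (1 : R)) * x^-1)) => //; last first.
  exact: cvg_cst.
near=> x.
have x0 : 0 < x by near: x; exact: nbhs_pinfty_gt.
rewrite /xphi mulr_ge0 ?(ltW x0)//= phiE mulrCA.
rewrite (_ : 2 * _ * _ = normal_peak 1 * (2 * x^-1)); last by ring.
rewrite ler_wpM2l ?normal_peak_ge0// expRN ler_pdivrMr ?expR_gt0//.
have := expR_ge1Dx (x ^+ 2 / 2) => e.
have : 2 * x^-1 * (x ^+ 2 / 2) <= 2 * x^-1 * expR (x ^+ 2 / 2).
  by rewrite ler_wpM2l ?mulr_ge0 ?invr_ge0 ?(ltW x0)//; lra.
apply: le_trans; rewrite le_eqVlt; apply/orP; left; apply/eqP; field.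
by rewrite gt_eqF.
Unshelve. all: by end_near. Qed.

(* (x phi)' = (1 - x^2) phi changes sign at 1, hence the split of [0, +oo[ there. *)
Let x2phi_half : (\int[mu]_(x in `[0%R, +oo[) (x ^+ 2 * phi x)%:E =
  \int[mu]_(x in `[0%R, +oo[) (phi x)%:E)%E.
Proof.
have mx2 : measurable_fun setT (fun x => x ^+ 2 * phi x).
  by apply: measurable_funM => //; exact: measurable_funX.
have x20 x : 0 <= x ^+ 2 * phi x by rewrite mulr_ge0 ?sqr_ge0.
have cxphi A : {within A, continuous xphi}.
  apply: continuous_subspaceT => x; apply: cvgM; [exact: cvg_id|exact: cphi].
have c1 : continuous (fun x : R => (1 - x ^+ 2) * phi x).
  move=> x; apply: cvgM; last exact: cphi.
  by apply: cvgB; [exact: cvg_cst|exact: exprn_continuous].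
have c2 : continuous (fun x : R => (x ^+ 2 - 1) * phi x).
  move=> x; apply: cvgM; last exact: cphi.
  by apply: cvgB; [exact: exprn_continuous|exact: cvg_cst].
have e1 : (\int[mu]_(x in `[0%R, 1%R]) ((1 - x ^+ 2) * phi x)%:E = (phi 1)%:E)%E.
  rewrite (@continuous_FTC2 _ _ xphi)//.
  - by rewrite /xphi mul0r mul1r sube0.
  - exact: continuous_subspaceT.
  - split.
    + by move=> x _; case: (is_derive_xphi x).
    + by apply: cvg_at_right_filter; apply: cvgM; [exact: cvg_id|exact: cphi].
    + by apply: cvg_at_left_filter; apply: cvgM; [exact: cvg_id|exact: cphi].
  - by move=> x _; rewrite derive1E; case: (is_derive_xphi x).
have e2 : (\int[mu]_(x in `[1%R, +oo[) ((x ^+ 2 - 1) * phi x)%:E = (phi 1)%:E)%E.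
  have dN (x : R) : is_derive x 1 (- xphi) ((x ^+ 2 - 1) * phi x).
    have h := is_derive_xphi x.
    by apply: is_derive_eq; ring.
  rewrite (@ge0_continuous_FTC2y _ _ (- xphi) 1 0).
  - by rewrite opprfctE sub0e -EFinN opprK /xphi mul1r.
  - by move=> x x1; rewrite mulr_ge0// subr_ge0 expr_ge1// (le_trans _ x1).
  - exact: continuous_subspaceT.
  - by rewrite -oppr0; exact: cvgN.
  - by move=> x _; case: (dN x).
  - apply: cvg_at_right_filter; apply: cvgN.
    by apply: cvgM; [exact: cvg_id|exact: cphi].
  - by move=> x _; rewrite derive1E; case: (dN x).
have split (g : R -> R) : measurable_fun setT g -> (forall x, 0 <= g x) ->
    (\int[mu]_(x in `[0%R, +oo[) (g x)%:E =
     \int[mu]_(x in `[0%R, 1%R]) (g x)%:E + \int[mu]_(x in `[1%R, +oo[) (g x)%:E)%E.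
  move=> mg g0.
  rewrite -(@integral_itv_obnd_cbnd _ 1); last exact/measurable_EFinP/measurable_funTS.
  rewrite -ge0_integral_setU//=; last 3 first.
  - exact/measurable_EFinP/measurable_funTS.
  - by move=> x _; rewrite lee_fin.
  - apply/disj_setPS => x [/=]; rewrite !in_itv/= andbT => /andP[_ x1].
    by rewrite ltNge x1.
  congr (integral _ _ _); apply/seteqP; split => x/=; rewrite !in_itv/= !andbT.
    by move=> ->; case: (leP x 1); [left|right].
  by move=> [/andP[]//|/ltW]; exact: le_trans.
rewrite !split//.
(* On [0, 1] the integral of [phi] exceeds that of [x ^+ 2 * phi x] by [phi 1], and on [1, +oo[ it
   falls short by the same amount. Adding [phi 1] on each side avoids any subtraction of extended
   reals. *)
have -> : (\int[mu]_(x in `[0%R, 1%R]) (phi x)%:E =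
  \int[mu]_(x in `[0%R, 1%R]) (x ^+ 2 * phi x)%:E + (phi 1)%:E)%E.
  rewrite -e1 -ge0_integralD//=.
  - by apply: eq_integral => x _; rewrite -EFinD; congr (_%:E); ring.
  - by move=> x _; rewrite lee_fin.
  - exact/measurable_EFinP/measurable_funTS.
  - move=> x; rewrite in_itv/= => /andP[x0 x1]; rewrite lee_fin mulr_ge0//.
    by rewrite subr_ge0 expr_le1.
  - by apply/measurable_EFinP/measurable_funTS; exact: continuous_measurable_fun.
have -> : (\int[mu]_(x in `[1%R, +oo[) (x ^+ 2 * phi x)%:E =
  (phi 1)%:E + \int[mu]_(x in `[1%R, +oo[) (phi x)%:E)%E.
  rewrite -e2 -ge0_integralD//=.
  - by apply: eq_integral => x _; rewrite -EFinD; congr (_%:E); ring.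
  - move=> x; rewrite in_itv/= andbT => x1; rewrite lee_fin mulr_ge0//.
    by rewrite subr_ge0 expr_ge1// (le_trans _ x1).
  - by apply/measurable_EFinP/measurable_funTS; exact: continuous_measurable_fun.
  - by move=> x _; rewrite lee_fin.
  - exact/measurable_EFinP/measurable_funTS.
by rewrite addeA.
Qed.

Lemma normal_prob_moment2 : (\int[N 1]_x (x ^+ 2)%:E = 1)%E.
Proof.
etransitivity.
  apply: (@ge0_integral_normal_prob 1 (fun x => (x ^+ 2)%:E)).
    by apply/measurable_EFinP; exact: measurable_funX.
  by move=> x; rewrite lee_fin sqr_ge0.
have <- := integral_normal_pdf 0 (1 : R).
rewrite !ge0_symfun_integralT//.
- rewrite -set_itvcy; congr (_ * _)%E; exact: x2phi_half.
- by move=> x /=; rewrite phiN.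
- by move=> x; rewrite mulr_ge0 ?sqr_ge0.
- by move=> x; apply: cvgM; [exact: exprn_continuous|exact: cphi].
- by move=> x /=; rewrite phiN sqrrN.
Qed.

Let ge0_integral_normal_probN (g : R -> \bar R) : measurable_fun setT g ->
  (forall x, 0 <= g x)%E -> (\int[N 1]_x g (- x)%R = \int[N 1]_x g x)%E.
Proof.
move=> mg g0.
have mN : measurable_fun setT (-%R : measurableTypeR R -> measurableTypeR R).
  exact: oppr_measurable.
have mgN : measurable_fun setT (fun x : R => g (- x)) by exact: measurableT_comp.
etransitivity; first exact: (@ge0_integral_normal_prob 1 (fun x => g (- x)) mgN).
etransitivity; last exact: (esym (ge0_integral_normal_prob 1 mg g0)).
pose h (x : R) := (g x * (phi x)%:E)%E.
have mh : measurable_fun setT h by apply: emeasurable_funM => //; exact/measurable_EFinP.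
transitivity (\int[mu]_x h (- x)%R)%E.
  by apply: eq_integral => x _; rewrite /h phiN.
etransitivity.
  apply: esym; have := @ge0_integral_pushforward _ _ (measurableTypeR R) (measurableTypeR R)
    R -%R mN mu setT h measurableT mh.
  rewrite preimage_setT; apply => x _; rewrite mule_ge0// lee_fin//.
by apply: eq_measure_integral => /= A mA _; exact: lebesgue_measureN.
Qed.

Lemma normal_prob_moment1 : Rintegral (N 1) setT (fun x : R => x) = 0.
Proof.
rewrite /Rintegral integralE.
have -> : (\int[N 1]_x ((fun x : R => x%:E)^\- x) =
    \int[N 1]_x ((fun x : R => x%:E)^\+ x))%E.
  have mp : measurable_fun setT ((fun x : R => x%:E)^\+)%E.
    by apply: measurable_funepos; exact/measurable_EFinP.
  etransitivity; last exact: (ge0_integral_normal_probN mp (funepos_ge0 _)).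
  by apply: eq_integral => x _; rewrite funenegE funeposE EFinN.
(* Were the common value infinite, the difference would be infinite too, and [fine] would still send
   it to 0. *)
by case: (\int[N 1]_x _)%E => //= r; rewrite subrr.
Qed.

End normal.

(** * Sums of independent random variables *)

Section independence.
Context {R : realType} d (T : measurableType d) (P : probability T R).

(** If [P E] is not 0, dividing the left side by it gives a measure in [C] that agrees with the
    product law on rectangles, hence everywhere. The event [E] will carry the variables not yet
    summed. *)
Lemma joint_law (X Y : {RV P >-> R}) (E : set T) : measurable E ->
  (forall A B, measurable A -> measurable B ->
    P (X @^-1` A `&` Y @^-1` B `&` E) = P (X @^-1` A) * P (Y @^-1` B) * P E)%E ->
  forall C : set (R * R), measurable C ->
    P ((fun w => (X w, Y w)) @^-1` C `&` E) =
    ((distribution P X \x distribution P Y) C * P E)%E.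
Proof.
move=> mE XYE C mC.
have mXY : measurable_fun setT (fun w => (X w, Y w)).
  by apply: measurable_fun_pair; exact: measurable_funPT.
have mXYC : measurable ((fun w => (X w, Y w)) @^-1` C).
  by rewrite -[X in measurable X]setTI; exact: mXY.
have [E0|E0] := eqVneq (P E) 0%E.
  rewrite E0 mule0; apply/eqP; rewrite eq_le measure_ge0 andbT -E0.
  by apply: le_measure; rewrite ?inE//; exact: measurableI.
have p0 : 0 <= (fine (P E))^-1 by rewrite invr_ge0 fine_ge0.
have [m' m'E] : exists m' : {measure set (R * R)%type -> \bar R}, forall A,
    m' A = (((fine (P E))^-1)%:E * P ((fun w => (X w, Y w)) @^-1` A `&` E))%E.
  unshelve eexists (mscale (NngNum p0)
    (pushforward (mrestr P mE) (fun w => (X w, Y w)))); [exact: mXY|by []].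
have PEE : (P E * (fine (P E))^-1%:E)%E = 1%E.
  rewrite -{1}(@fineK _ (P E)) ?fin_num_measure// -EFinM divff//.
  by rewrite fine_eq0// fin_num_measure.
have <- : m' C = (distribution P X \x distribution P Y)%E C.
  apply/esym; apply: product_measure_unique => // A B mA mB.
  rewrite m'E /=.
  have -> : [set x | (A `*` B) (X x, Y x)] `&` E =
      X @^-1` A `&` Y @^-1` B `&` E by [].
  rewrite XYE// /distribution /pushforward muleC -muleA PEE mule1//.
rewrite m'E -muleA muleC -muleA PEE mule1//.
Qed.

Section partial_sums.
Variables (xi : nat -> {RV P >-> R}) (g : R -> R).
Hypotheses (xi_indep : independent_RVs xi) (xi_id : identically_distributed xi).
Hypothesis mg : measurable_fun setT g.

Definition partial_sum (k : nat) (w : T) : R := \sum_(i < k) g (xi i w).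

Let mgxi i : measurable_fun setT (g \o xi i).
Proof. by apply: measurableT_comp => //; exact: measurable_funPT. Qed.

Lemma measurable_partial_sum k : measurable_fun setT (partial_sum k).
Proof. by apply: measurable_sum => i; exact: mgxi. Qed.

HB.instance Definition _ k := isMeasurableFun.Build _ _ _ _ (partial_sum k)
  (measurable_partial_sum k).

Let evt (J : {fset nat}) (B : nat -> set R) :=
  \bigcap_(i in [set` J]) (xi i @^-1` B i).

Let measurable_xi i B : measurable B -> measurable (xi i @^-1` B).
Proof. by move=> mB; rewrite -[X in measurable X]setTI; exact: measurable_funPT. Qed.

Let measurable_evt J B : (forall i, measurable (B i)) -> measurable (evt J B).
Proof. by move=> mB; apply: fin_bigcap_measurable => // i _; exact: measurable_xi. Qed.

Let evt1 k B (J : {fset nat}) C : measurable B -> (forall i, measurable (C i)) ->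
  k \notin J ->
  exists2 C' : nat -> set R, (forall i, measurable (C' i)) &
    xi k @^-1` B `&` evt J C = evt (k |` J)%fset C' /\
    (P (xi k @^-1` B `&` evt J C) = P (xi k @^-1` B) * P (evt J C))%E.
Proof.
move=> mB mC kJ; pose C' i := if i == k then B else C i.
have mC' i : measurable (C' i) by rewrite /C'; case: ifP.
have e : xi k @^-1` B `&` evt J C = evt (k |` J)%fset C'.
  apply/seteqP; split=> [w [Bw Cw] i /=|w Cw].
    rewrite in_fset1U /C' => /orP[/eqP ->|iJ]; first by rewrite eqxx.
    by case: ifPn => [/eqP ->//|_]; exact: Cw.
  split; first by have := Cw k; rewrite /C' eqxx; apply; rewrite /= fset1U1.
  move=> i /= iJ; have := Cw i; rewrite /C' ifF; last first.
    by apply/eqP => ik; move: kJ; rewrite -ik iJ.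
  by apply; rewrite /= in_fset1U iJ orbT.
exists C' => //; split => //.
rewrite e !xi_indep// big_fsetU1//= /C' eqxx EFinM fineK ?fin_num_measure//; last first.
  exact: measurable_xi.
congr (_ * _%:E)%E; apply: eq_big_seq => i iJ /=.
by case: eqP => // ik; move: kJ; rewrite -ik iJ.
Qed.

(* Intersecting with events on the later variables strengthens the induction on k. *)
Let partial_sum_evt k (J : {fset nat}) B A : (forall i, i \in J -> k <= i)%N ->
  (forall i, measurable (B i)) -> measurable A ->
  (P (partial_sum k @^-1` A `&` evt J B) =
   P (partial_sum k @^-1` A) * P (evt J B))%E.
Proof.
elim: k J B A => [|k IH] J B A Jk mB mA.
  have [A0|A0] := pselect (A 0).
    have -> : partial_sum 0 @^-1` A = setT.
      by apply/seteqP; split => // w _; rewrite /preimage/= /partial_sum big_ord0.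
    by rewrite setTI probability_setT mul1e.
  have -> : partial_sum 0 @^-1` A = set0.
    by apply/seteqP; split => // w; rewrite /preimage/= /partial_sum big_ord0.
  by rewrite set0I measure0 mul0e.
pose C : set (R * R) :=
  [set p | A (p.1 + g p.2)].
have mC : measurable C.
  have h : measurable_fun setT
      (fun p : R * R => p.1 + g p.2).
    by apply: measurable_funD => //; exact: measurableT_comp.
  by rewrite -[X in measurable X]setTI; exact: h.
have SC : partial_sum k.+1 @^-1` A =
    (fun w => (partial_sum k w, xi k w)) @^-1` C.
  by apply/seteqP; split => w; rewrite /preimage/= /C/= /partial_sum big_ord_recr.
have key (L : {fset nat}) (D : nat -> set R) :
    (forall i, i \in L -> k < i)%N -> (forall i, measurable (D i)) ->
    (P (partial_sum k.+1 @^-1` A `&` evt L D) =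
     (distribution P (partial_sum k) \x distribution P (xi k)) C * P (evt L D))%E.
  move=> Lk mD; rewrite SC; apply: joint_law => // [|A' B' mA' mB'].
    exact: measurable_evt.
  have kL : k \notin L by apply/negP => /Lk; rewrite ltnn.
  have [C' mC' [e eP]] := evt1 mB' mD kL.
  rewrite -setIA e IH// -?e ?eP ?muleA// => i.
  by rewrite in_fset1U => /orP[/eqP ->//|/Lk/ltnW].
(* The product-law factor in [key] does not involve [L]; the case of an empty [L] identifies it as
   the probability of the event on [partial_sum k.+1]. *)
rewrite key//; congr (_ * _)%E.
have := key fset0 B _ mB; rewrite {1 2}/evt.
have -> : \bigcap_(i in [set` fset0]) (xi i @^-1` B i) = setT.
  by apply/seteqP; split => // w _ i /=; rewrite in_fset0.
by rewrite setIT probability_setT mule1 => -> // i; rewrite in_fset0.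
Qed.

(** By independence the pair [(partial_sum k, xi k)] has a product law, and identical distribution
    replaces [xi k] by [xi 0], so that one and the same operator is added at each step. *)
Lemma avg_partial_sumS k f : unit_fun f ->
  avg P (partial_sum k.+1) f = avg P (partial_sum k) (avg P (g \o xi 0%N) f).
Proof.
move=> uf; apply/funext => y; apply: EFin_inj.
have mS := measurable_partial_sum.
rewrite !avgE//; last exact: unit_fun_avg.
under [RHS]eq_integral do rewrite avgE//.
have mXY : measurable_fun setT (fun w => (partial_sum k w, xi k w)).
  by apply: measurable_fun_pair; exact: measurable_funPT.
pose h (p : R * R) := (f (y + p.1 + g p.2))%:E.
have mh : measurable_fun setT h.
  apply/measurable_EFinP; apply: measurableT_comp; first exact: uf.1.
  apply: measurable_funD; first exact: measurable_funD.
  exact: measurableT_comp.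
have h0 p : (0 <= h p)%E by rewrite lee_fin; case/andP: (uf.2 (y + p.1 + g p.2)).
transitivity (\int[P]_w h (partial_sum k w, xi k w))%E.
  by apply: eq_integral => w _; rewrite /h /partial_sum big_ord_recr/= addrA.
have hp := @ge0_integral_pushforward _ _ _ _ _ _ mXY P setT h measurableT mh
  (fun p _ => h0 p).
rewrite preimage_setT in hp; etransitivity; first exact: esym hp.
transitivity (\int[distribution P (partial_sum k) \x distribution P (xi 0%N)]_p h p)%E.
  apply: eq_measure_integral => /= A mA _.
  apply/esym; apply: product_measure_unique => // B C mB mC /=.
  pose D i := if i == k then C else setT.
  have mD i : measurable (D i) by rewrite /D; case: ifP.
  have := @partial_sum_evt k [fset k]%fset D B _ mD mB.
  rewrite /evt set_fset1 bigcap_set1 /D eqxx => e.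
  rewrite /pushforward (_ : _ @^-1` _ = partial_sum k @^-1` B `&` xi k @^-1` C)//.
  rewrite e//; last by move=> i; rewrite in_fset1 => /eqP ->.
  by congr (_ * _)%E; exact: xi_id.
rewrite (fubini_tonelli1 h)//.
etransitivity.
  apply: (@ge0_integral_pushforward _ _ _ _ _ _ (measurable_partial_sum k) P setT) => //.
  exact: measurable_fun_fubini_tonelli_F.
  by move=> x _; apply: integral_ge0.
rewrite preimage_setT; apply: eq_integral => w _ /=; rewrite /fubini_F.
etransitivity.
  apply: (@ge0_integral_pushforward _ _ _ _ _ _ (measurable_funPT (xi 0%N)) P setT) => //.
  exact: measurableT_comp.
by rewrite preimage_setT.
Qed.
End partial_sums.
End independence.

(** * Trotter's comparison and the limit theorem for rows *)

Section clt.
Context {R : realType} d (T : measurableType d) (P : probability T R).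
Local Notation N s := (normal_prob (0 : R) s).
Variable xi : nat -> {RV P >-> R}.
Hypotheses (xi_indep : independent_RVs xi) (xi_id : identically_distributed xi).

(** Each added summand is exchanged for a normal one at cost [d0], contraction keeping the earlier
    costs from growing. The count starts at one summand because an empty sum is a point mass, not a
    normal law of positive deviation. *)
Lemma avg_partial_sum_normal (g f : R -> R) (s d0 : R) : 0 < s ->
  measurable_fun setT g -> continuous f -> unit_fun f ->
  (forall y, `|avg P (g \o xi 0%N) f y - avg (N s) idfun f y| <= d0) ->
  forall k y, `|avg P (partial_sum xi g k.+1) f y -
                avg (N (s * Num.sqrt k.+1%:R)) idfun f y| <= k.+1%:R * d0.
Proof.
move=> s0 mg cf uf gN; elim=> [|k IH] y.
  have -> : partial_sum xi g 1 = g \o xi 0%N.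
    by apply/funext => w; rewrite /partial_sum big_ord1.
  by rewrite sqrtr1 mulr1 mul1r; exact: gN.
have mid : measurable_fun setT (idfun : R -> R) by exact: measurable_id.
have mS := measurable_partial_sum xi mg.
have mgxi : measurable_fun setT (g \o xi 0%N).
  by apply: measurableT_comp => //; exact: measurable_funPT.
have sk : Num.sqrt (s ^+ 2 + (s * Num.sqrt k.+1%:R) ^+ 2) = s * Num.sqrt k.+2%:R.
  rewrite exprMn sqr_sqrtr// -{1}(mulr1 (s ^+ 2)) -mulrDr sqrtrM ?sqr_ge0//.
  by rewrite sqrtr_sqr gtr0_norm// nat1r.
rewrite avg_partial_sumS// -sk -avg_normal_convolution//; last first.
  by rewrite mulr_gt0// sqrtr_gt0 ltr0n.
have -> : k.+2%:R * d0 = d0 + k.+1%:R * d0 by rewrite -nat1r mulrDl mul1r.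
have uY := unit_fun_avg P mgxi uf.
have uN := unit_fun_avg (N s) mid uf.
have uS := unit_fun_avg P (mS k.+1) uf.
have uNk := unit_fun_avg (N (s * Num.sqrt k.+1%:R)) mid uf.
(* Replace the last summand first, then, as the operators commute, the others. *)
rewrite -(subrKA (avg P (partial_sum xi g k.+1) (avg (N s) idfun f) y)).
apply: le_trans (ler_normD _ _) _; apply: lerD.
  exact: (avg_le P (mS k.+1) y uY uN gN).
have -> := avg_avgC P (N s) (mS k.+1) mid uf.
exact: (avg_le (N s) mid y uS uNk IH).
Qed.

Section triangular.
Variables (W U G : T -> R) (C : nat -> T -> R) (sigma : R) (g : nat -> R -> R).
Hypothesis sigma0 : 0 < sigma.
Hypothesis mg : forall n, measurable_fun setT (g n).
Hypotheses (mW : measurable_fun setT W) (mU : measurable_fun setT U)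
  (mC : forall n, measurable_fun setT (C n)).
Hypotheses (iW2 : P.-integrable setT (EFin \o (fun w => W w ^+ 2)))
  (iU : P.-integrable setT (EFin \o U)) (iG : P.-integrable setT (EFin \o G)).
Hypotheses (W0 : (\int[P]_w W w = 0)%R) (W2 : (\int[P]_w W w ^+ 2 = sigma ^+ 2)%R)
  (U0 : (\int[P]_w U w = 0)%R).
Hypotheses (CG : forall n w, n%:R * Num.min 1 `|C n w| <= G w)
  (C0 : forall w, n%:R * Num.min 1 `|C n w| @[n --> \oo] --> (0 : R)).
Hypothesis gE : forall n w,
  g n (xi 0%N w) = W w / Num.sqrt n%:R + U w / n%:R + C n w.

Lemma cvg_avg_partial_sum K f f1 f2 y : test_function K f f1 f2 ->
  avg P (partial_sum xi (g n) n) f y @[n --> \oo] --> avg (N sigma) idfun f y.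
Proof.
move=> tf.
have cf := test_function_continuous tf.
have uf : unit_fun f.
  split; last exact: test_function_itv tf.
  exact: continuous_measurable_fun.
have [e e0 He] := avg_expansion mW mU mC iW2 iU iG W0 W2 U0 CG C0 tf.
(* The normal summand is expanded by the same lemma, on the space of the standard normal law, with
   [W = sigma z] and [U = C = 0]. Both expansions have the term [sigma ^+ 2 / (2 n) * f2], which
   cancels in the difference. *)
pose WN (z : measurableTypeR R) : R := sigma * z.
pose zero (z : measurableTypeR R) : R := 0.
have mWN : measurable_fun setT WN by exact: measurable_funM.
have mzero : measurable_fun setT zero by exact: measurable_cst.
have iz : (N 1).-integrable setT (EFin \o zero) by exact: integrable0.
have iz2 : (N 1).-integrable setT (EFin \o (fun z : measurableTypeR R => z ^+ 2)).
  apply/integrableP; split; first by apply/measurable_EFinP; exact: measurable_funX.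
  under eq_integral do rewrite /= ger0_norm ?sqr_ge0//.
  by have := @normal_prob_moment2 R; rewrite /= => ->; rewrite ltry.
have iWN2 : (N 1).-integrable setT (EFin \o (fun z => WN z ^+ 2)).
  apply: eq_integrable (integrableZl _ (sigma ^+ 2) iz2) => // z _.
  by rewrite /WN /= exprMn.
have iz1 : (N 1).-integrable setT (EFin \o (fun z : measurableTypeR R => z : R)).
  have i1 := finite_measure_integrable_cst (N 1) (1 : R) measurableT.
  apply: le_integrable (integrableD _ i1 iz2) => //; first exact/measurable_EFinP.
  move=> z _ /=; rewrite lee_fin [leRHS]ger0_norm ?addr_ge0 ?sqr_ge0//.
  have := sqr_ge0 (1 - `|z : R|); rewrite sqrrB real_normK ?num_real// => h.
  by have := normr_ge0 (z : R); lra.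
have WN0 : Rintegral (N 1) setT WN = 0.
  rewrite /WN RintegralZl//; have := @normal_prob_moment1 R => ->.
  by rewrite mulr0.
have WN2 : Rintegral (N 1) setT (fun z => WN z ^+ 2) = sigma ^+ 2.
  rewrite (_ : (fun z => WN z ^+ 2) = fun z => sigma ^+ 2 * z ^+ 2); last first.
    by apply/funext => z; rewrite /WN exprMn.
  rewrite RintegralZl// /Rintegral; have := @normal_prob_moment2 R => ->.
  by rewrite mulr1.
have zero0 : Rintegral (N 1) setT zero = 0.
  by rewrite /Rintegral integral0.
have [||e' e'0 He'] := avg_expansion mWN mzero (fun _ => mzero) iWN2 iz iz
  WN0 WN2 zero0 _ _ tf.
- by move=> n z; rewrite /zero normr0 minC min_l// mulr0.
- move=> z; rewrite (_ : (fun _ => _) = cst 0); first exact: cvg_cst.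
  by apply/funext => n; rewrite /zero normr0 minC min_l// mulr0.
apply: cvg_sub0 (cvg_cst _).
apply/norm_cvg0P.
apply: (@squeeze_cvgr _ _ _ _ (cst 0) (fun n => e n + e' n)); last first.
- by rewrite -(addr0 0); exact: cvgD.
- exact: cvg_cst.
near=> n.
have n0 : (0 < n)%N by near: n; exists 1%N.
have nR : (0 : R) < n%:R by rewrite ltr0n.
rewrite normr_ge0 /=.
pose s := sigma / Num.sqrt n%:R.
have s0 : 0 < s by rewrite divr_gt0// sqrtr_gt0.
have h z : `|avg P (g n \o xi 0%N) f z - avg (N s) idfun f z| <= (e n + e' n) / n%:R.
  have -> : g n \o xi 0%N = fun w => W w / Num.sqrt n%:R + U w / n%:R + C n w.
    by apply/funext => w; rewrite /= gE.
  have -> : avg (N s) idfun f z = avg (N 1)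
      (fun z => WN z / Num.sqrt n%:R + zero z / n%:R + zero z) f z.
    rewrite -(avg_normal_scale z s0 cf uf); congr (avg _ _ f z).
    by apply/funext => w; rewrite /WN /zero mul0r !addr0 mulrAC.
  have := He n z n0; have := He' n z n0.
  set a := avg (N 1) _ f z; set b := avg P _ f z; set c := _ * f2 z.
  move=> h1 h2; rewrite mulrDl.
  rewrite (_ : b - a = (b - f z - c) - (a - f z - c)); last by ring.
  by apply: le_trans (ler_normB _ _) _; exact: lerD.
have := avg_partial_sum_normal s0 (mg n) cf uf h n.-1 y.
rewrite prednK// (_ : s * _ = sigma); last first.
  by rewrite /s divfK// gt_eqF// sqrtr_gt0.
by rewrite mulrC divfK ?gt_eqF.
Unshelve. all: by end_near. Qed.

End triangular.
End clt.

(** * From averages of logistic functions to distribution functions *)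

Section logistic_sandwich.
Context {R : realType} d (T : measurableType d) (P : probability T R).
Variables (X : T -> R) (f : R -> R) (e eta : R).
Hypotheses (mX : measurable_fun setT X) (uf : unit_fun f).

Let mXi c : measurable (X @^-1` `]-oo, c]).
Proof. by rewrite -[X in measurable X]setTI; exact: mX. Qed.

Let Eindic (A : set T) (b : R) : measurable A ->
  (\int[P]_w (\1_A w + b) = fine (P A) + b)%R.
Proof.
move=> mA; rewrite RintegralD//; last 2 first.
- exact: integrable_indic.
- exact: finite_measure_integrable_cst.
rewrite Rintegral_cst// [X in b * fine X]probability_setT mulr1; congr (_ + _).
by rewrite /Rintegral integral_indic// setIT.
Qed.

Let iindic (A : set T) (b : R) : measurable A ->
  P.-integrable setT (EFin \o (fun w => \1_A w + b)).
Proof.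
move=> mA; apply: eq_integrable (integrableD _ (integrable_indic P mA)
  (finite_measure_integrable_cst P b _)) => //.
Qed.

(** Integrates the pointwise bound [1_(X <= c - e) - eta <= f (X - c)]. *)
Lemma prob_le_avg c : (forall x, x <= - e -> 1 - eta <= f x) ->
  0 <= eta -> fine (P (X @^-1` `]-oo, c - e])) <= avg P X f (- c) + eta.
Proof.
move=> fe eta0; rewrite -lerBlDr -(Eindic (- eta) (mXi (c - e))).
apply: le_Rintegral => //; [exact: iindic|exact: integrable_unit_fun|].
move=> w _; rewrite indicE; case: (boolP (w \in _)) => [|_].
  rewrite inE/= in_itv/= => h; apply: fe; lra.
have /andP[f0 _] := uf.2 (- c + X w); rewrite add0r; apply: le_trans f0; lra.
Qed.

Lemma avg_le_prob c : (forall x, e <= x -> f x <= eta) ->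
  0 <= eta -> avg P X f (- c) <= fine (P (X @^-1` `]-oo, c + e])) + eta.
Proof.
move=> fe eta0; rewrite -(Eindic eta (mXi (c + e))).
apply: le_Rintegral => //; [exact: integrable_unit_fun|exact: iindic|].
move=> w _; rewrite indicE; case: (boolP (w \in _)) => [_|].
  by have /andP[_ f1] := uf.2 (- c + X w); apply: le_trans f1 _; rewrite /=; lra.
rewrite notin_setE/= in_itv/= => /negP; rewrite -ltNge => h.
by rewrite /= add0r; apply: fe; lra.
Qed.

End logistic_sandwich.

Lemma cvg_prob_of_cvg_avg {R : realType} d (T : measurableType d)
    (P : probability T R) (S : nat -> T -> R)
    (mu : probability (measurableTypeR R) R) (x : R) :
  (forall n, measurable_fun setT (S n)) ->
  (forall l y : R, 0 < l -> avg P (S n) (logistic l) y @[n --> \oo] -->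
    avg mu idfun (logistic l) y) ->
  {for x, continuous (fun y : R => mu `]-oo, y]%classic)} ->
  P (S n @^-1` `]-oo, x]%classic) @[n --> \oo] --> mu `]-oo, x]%classic.
Proof.
move=> mS Sl cmu.
have fmu z : mu `]-oo, z]%classic \is a fin_num by rewrite fin_num_measure.
have mSi n : measurable (S n @^-1` `]-oo, x]).
  by rewrite -[X in measurable X]setTI; exact: mS.
have mid : measurable_fun setT (idfun : measurableTypeR R -> R) by exact: measurable_id.
have ul (l : R) : 0 < l -> unit_fun (logistic l).
  move=> l0; have [K [f1 [f2 tf]]] := @test_function_logistic R l l0.
  split; last exact: test_function_itv tf.
  by apply: continuous_measurable_fun; exact: test_function_continuous tf.
rewrite -(fineK (fmu x)).
apply/fine_cvgP; split; first by apply: nearW => n; rewrite fin_num_measure.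
have cF : fine (mu `]-oo, z]%classic) @[z --> x] --> fine (mu `]-oo, x]%classic).
  by apply: fine_cvg; rewrite fineK//; exact: cmu.
apply/cvgrPdist_le => eps eps0.
have e4 : 0 < eps / 4 by rewrite divr_gt0.
(* Each of the two inequalities spends four quarters of [eps]: continuity of the limit distribution
   function, convergence of the averages, and the logistic error once under [P] and once under [mu].
   The thresholds reach [x + 2 e] and [x - 2 e], hence [e = r / 4] below. *)
have arith (F Fu Fd M1 A1 M2 A2 p : R) : `|F - Fu| <= eps / 4 ->
    `|F - Fd| <= eps / 4 -> `|M1 - A1| <= eps / 4 -> `|M2 - A2| <= eps / 4 ->
    p <= A1 + eps / 4 -> M1 <= Fu + eps / 4 -> A2 <= p + eps / 4 ->
    Fd <= M2 + eps / 4 -> `|F - p| <= eps.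
  rewrite !ler_norml => /andP[? ?] /andP[? ?] /andP[? ?] /andP[? ?] ? ? ? ?.
  by apply/andP; split; lra.
move/cvgrPdist_le : cF => /(_ _ e4)[/= r r0 Hr].
pose e := r / 4; have e0 : 0 < e by rewrite divr_gt0.
have [l l0 [lN lP]] := logistic_step e0 e4.
have Hup : `|fine (mu `]-oo, x]%classic) -
    fine (mu `]-oo, x + e + e]%classic)| <= eps / 4.
  apply: Hr => /=; rewrite /e -addrA opprD addNKr normrN gtr0_norm; lra.
have Hdn : `|fine (mu `]-oo, x]%classic) -
    fine (mu `]-oo, x - e - e]%classic)| <= eps / 4.
  apply: Hr => /=; rewrite (_ : x - (x - e - e) = e + e); last by ring.
  rewrite /e gtr0_norm; lra.
have /cvgrPdist_le /(_ _ e4) h1 := Sl l (- (x + e)) l0.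
have /cvgrPdist_le /(_ _ e4) h2 := Sl l (- (x - e)) l0.
suff key n : `|avg mu idfun (logistic l) (- (x + e)) -
      avg P (S n) (logistic l) (- (x + e))| <= eps / 4 ->
    `|avg mu idfun (logistic l) (- (x - e)) -
      avg P (S n) (logistic l) (- (x - e))| <= eps / 4 ->
    `|fine (mu `]-oo, x]%classic) - fine (P (S n @^-1` `]-oo, x]%classic))| <= eps.
  exact: (filterS2 _ key h1 h2).
move=> k1 k2.
have a1 := prob_le_avg P (mS n) (ul l l0) (x + e) lN (ltW e4).
have a2 := avg_le_prob mu mid (ul l l0) (x + e) lP (ltW e4).
have a3 := avg_le_prob P (mS n) (ul l l0) (x - e) lP (ltW e4).
have a4 := prob_le_avg mu mid (ul l l0) (x - e) lN (ltW e4).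
rewrite addrK in a1; rewrite subrK in a3; rewrite !preimage_id in a2 a4.
exact: (arith _ _ _ _ _ _ _ _ Hup Hdn k1 k2 a1 a2 a3 a4).
Qed.

(** * Deviation means of random samples *)

Section deviation_mean.
Context {R : realType} (I : set R) (D : R -> R -> R).
Hypotheses (I_itv : is_interval I) (D_dev : deviation I D).

Section deterministic.
Variables (n : nat) (x : 'I_n -> R).
Hypotheses (n0 : (0 < n)%N) (xI : forall i, I (x i)).

Let F t := \sum_(i < n) D (x i) t.

Let sum_decreasing s t : I s -> I t -> s < t -> F t < F s.
Proof.
move=> Is It st; apply: ltr_sum => [|i _].
  by apply/hasP; exists (Ordinal n0) => //; rewrite mem_index_enum.
by case: (D_dev.1 _ (xI i)) => + _; apply.
Qed.

Let continuous_sum : {within I, continuous F}.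
Proof.
have -> : F = \sum_(i < n) D (x i) by apply/funext => t; rewrite /F fct_sumE.
apply: (big_ind (fun f : R -> R => {within I, continuous f})) => [|f g cf cg|i _].
- by move=> t; exact: cvg_cst.
- by move=> t; apply: cvgD; [exact: cf|exact: cg].
- exact: (D_dev.1 _ (xI i)).2.
Qed.

(** At the smallest [x i] every term of the sum is nonnegative and at the largest every term is
    nonpositive, so the intermediate value theorem gives a zero between them. *)
Lemma deviation_meanP : I (deviation_mean I D x) /\
  \sum_(i < n) D (x i) (deviation_mean I D x) = 0.
Proof.
suff [t It Ft] : exists2 t, I t & F t = 0.
  rewrite /deviation_mean; case: xgetP => [_ _ [] //|/(_ t)].
  by case; split.
pose i0 := Ordinal n0.
have [i _ mi] := @arg_minP _ _ _ i0 predT x erefl.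
have [j _ mj] := @arg_maxP _ _ _ i0 predT x erefl.
have Fi : 0 <= F (x i).
  apply: sumr_ge0 => k _; rewrite -(D_dev.2 _ (xI k)).
  have [->//|ik] := eqVneq (x i) (x k).
  apply/ltW; case: (D_dev.1 _ (xI k)) => + _; apply => //.
  by rewrite lt_neqAle ik mi.
have Fj : F (x j) <= 0.
  apply: sumr_le0 => k _; rewrite -(D_dev.2 _ (xI k)).
  have [->//|ik] := eqVneq (x j) (x k).
  apply/ltW; case: (D_dev.1 _ (xI k)) => + _; apply => //.
  by rewrite lt_neqAle eq_sym ik; exact: mj.
have ij : x i <= x j by exact: mi.
have sub : `[x i, x j]%classic `<=` I.
  by move=> t /=; rewrite in_itv/=; exact: I_itv.
have [||c cij Fc] := @IVT _ F _ _ 0 ij.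
- exact: continuous_subspaceW sub continuous_sum.
- by rewrite ge_min Fj orbT le_max Fi.
by exists c => //; apply: sub.
Qed.

Lemma deviation_mean_le t : I t ->
  (deviation_mean I D x <= t) = (\sum_(i < n) D (x i) t <= 0).
Proof.
move=> It; have [Im Fm] := deviation_meanP.
apply/idP/idP => [|h].
  rewrite le_eqVlt => /predU1P[<-|mt]; first by rewrite Fm.
  by rewrite -[leRHS]Fm; apply/ltW; exact: (sum_decreasing Im It mt).
rewrite leNgt; apply/negP => tm; have := sum_decreasing It Im tm.
by rewrite /F Fm ltNge h.
Qed.

End deterministic.

Section random.
Context d (T : measurableType d) (P : probability T R).
Variable xi : nat -> {RV P >-> R}.
Hypotheses (D_meas : borel_measurable_fst I D).

Let mI : measurable I. Proof. exact: is_interval_measurable. Qed.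

(** The finite index set of naturals is the form in which independence computes this probability. *)
Definition all_in (n : nat) : set T :=
  \bigcap_(i in [set` [fset j in iota 0 n]%fset]) (xi i @^-1` I).

Lemma all_inP n w : all_in n w <-> forall i : 'I_n, I (xi i w).
Proof.
split => [h i|h i /=].
  by have := h (i : nat); apply; rewrite /= !inE/= mem_iota/= add0n.
by rewrite !inE/= mem_iota/= add0n => ni; exact: (h (Ordinal ni)).
Qed.

Lemma measurable_all_in n : measurable (all_in n).
Proof.
apply: fin_bigcap_measurable => // i _.
by rewrite -[X in measurable X]setTI; exact: measurable_funPT.
Qed.

Lemma prob_all_in n : independent_RVs xi -> identically_distributed xi ->
  P (xi 0%N @^-1` I) = 1%E -> P (all_in n) = 1%E.
Proof.
move=> xi_indep xi_id xiI; rewrite /all_in (xi_indep _ (fun=> I))//.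
rewrite big1_seq// => i _; have := xi_id i I mI.
by rewrite /distribution /pushforward => ->; rewrite xiI.
Qed.

(** On [all_in n], the event that the mean exceeds [t] says that the sum at [t] is positive when [t]
    is in [I]; for [t] outside the interval [I] it is everything or nothing. Off [all_in n] the mean
    has the default value 0. *)
Lemma measurable_deviation_mean n :
  measurable_fun setT (fun w => deviation_mean I D (fun i : 'I_n => xi i w)).
Proof.
have [->|n0] := posnP n.
  rewrite (_ : (fun _ => _) = cst (deviation_mean I D (fun i : 'I_0 => 0)))//.
  by apply/funext => w; congr deviation_mean; apply/funext => -[].
pose M w := deviation_mean I D (fun i : 'I_n => xi i w).
have M0 w : ~ all_in n w -> M w = 0.
  move=> wA; rewrite /M /deviation_mean; case: xgetP => // y _ [+ _ _].
  by move=> /all_inP.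
apply: (measurability _ (RGenOInfty.measurableE R)) => //.
move=> _ [_ [t ->] <-]; rewrite setTI.
suff [B mB BE] : exists2 B, measurable B & forall w, all_in n w -> (t < M w <-> B w).
  rewrite (_ : _ @^-1` _ = (all_in n `&` B) `|` (~` all_in n `&` [set w | t < 0])).
    apply: measurableU; first by apply: measurableI => //; exact: measurable_all_in.
    apply: measurableI; first by apply: measurableC; exact: measurable_all_in.
    have [t0|t0] := boolP (t < 0); last by rewrite (_ : [set _ | _] = set0)// -subset0.
    by rewrite (_ : [set _ | _] = setT)//; apply/seteqP; split.
  apply/seteqP; split => w; rewrite /preimage/= in_itv/= andbT.
    have [wA|wA] := pselect (all_in n w); first by move=> /(BE _ wA); left.
    by rewrite -/(M w) M0//; right.
  by move=> [[wA /(BE _ wA)]//|[wA]]; rewrite -/(M w) M0.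
have [It|It] := pselect (I t).
  pose g := (D ^~ t) \_ I.
  have mg : measurable_fun setT g by apply/(measurable_restrictT _ _).1 => //; exact: D_meas.
  exists (partial_sum xi g n @^-1` `]0, +oo[).
    by rewrite -[X in measurable X]setTI; exact: measurable_partial_sum.
  move=> w /all_inP wA; rewrite /preimage/= in_itv/= andbT !ltNge.
  rewrite /M (deviation_mean_le n0 wA It) /partial_sum.
  by under [in X in _ <-> X]eq_bigr => i _ do rewrite /g patchE mem_set//.
have [[b Ib tb]|nb] := pselect (exists2 b, I b & t < b).
  exists setT => // w /all_inP wA; split=> // _.
  have [Im _] := deviation_meanP n0 wA.
  rewrite ltNge; apply/negP => Mt; apply: It.
  by apply: (I_itv Im Ib); rewrite Mt ltW.
exists set0 => // w /all_inP wA; split=> // tM; apply: nb.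
by exists (M w) => //; case: (deviation_meanP n0 wA).
Qed.

End random.
End deviation_mean.

(** * The exponent q and the growth of h near 0 *)

Lemma min1_le_powR {R : realType} (z b q : R) : 0 <= z -> z <= b -> 0 < q <= 1 ->
  Num.min 1 z <= b `^ q.
Proof.
move=> z0 zb /andP[q0 q1].
have h : z `^ q <= b `^ q.
  by apply: ge0_ler_powR; rewrite ?nnegrE ?(ltW q0)//; exact: le_trans zb.
apply: le_trans h; have [z1|z1] := leP 1 z.
  by rewrite -(powRr0 z); apply: ler_powR => //; exact: ltW.
move: z0; rewrite le_eqVlt => /predU1P[<-|z0]; first exact: powR_ge0.
rewrite -{1}(powRr1 (ltW z0)); apply: ger_powR => //.
by rewrite z0 ltW.
Qed.

(** The base is [y ^ (2 + alpha)] for [y = n ^ (-1/2)], the decay rate of the differentiability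
    error; the power [2 / (2 + alpha)] brings it back to [y ^ 2]. *)
Lemma powR_invn_invsqrtn {R : realType} (n : nat) (alpha : R) : (0 < n)%N -> 0 <= alpha ->
  (n%:R^-1 * (Num.sqrt n%:R)^-1 `^ alpha) `^ (2 / (2 + alpha)) = n%:R^-1 :> R.
Proof.
move=> n0 a0; pose y : R := (Num.sqrt n%:R)^-1.
have y0 : 0 < y by rewrite invr_gt0 sqrtr_gt0 ltr0n.
have y2 : y `^ 2 = n%:R^-1.
  by rewrite -[2]/(2%:R) powR_mulrn ?ltW// exprVn sqr_sqrtr.
rewrite -/y -y2 -powRD; last by rewrite (gt_eqF y0) implybT.
by rewrite -powRrM mulrCA divff ?mulr1// gt_eqF//; lra.
Qed.

Lemma limf_esup_at_right_bound {R : realType} (u : R -> R) (b : \bar R) :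
  (limf_esup (fun s => (u s)%:E) 0^'+ < b)%E ->
  exists2 e : R, 0 < e & exists2 c : \bar R, (c < b)%E &
    forall s, 0 < s < e -> ((u s)%:E <= c)%E.
Proof.
rewrite limf_esupE => /ereal_inf_lt[_ [V /= FV <-] Vb].
have [e /= e0 He] := FV; exists e => //.
exists (ereal_sup [set (u s)%:E | s in V]) => // s /andP[s0 se].
apply: ereal_sup_ubound; exists s => //; apply: He => //=.
by rewrite sub0r normrN gtr0_norm.
Qed.

(** The growth bound will serve the domination of the error and the limit its pointwise convergence.
    For [alpha = 0] both express that the upper limit is 0; for [alpha > 0] the bound implies the
    limit. *)
Lemma modulus_bound {R : realType} (h : R -> R) (r alpha : R) : 0 < r -> 0 <= alpha ->
  (forall s, 0 < s < r -> 0 <= h s) ->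
  (alpha = 0 -> limf_esup (fun s : R => (h s / s `^ alpha)%:E) 0^'+ = 0%E) ->
  (0 < alpha -> (limf_esup (fun s : R => (h s / s `^ alpha)%:E) 0^'+ < +oo)%E) ->
  (exists2 A : R, 0 <= A & exists2 e, 0 < e &
     forall s, 0 < s < e -> h s <= A * s `^ alpha) /\
  h x @[x --> 0^'+] --> (0 : R).
Proof.
move=> r0 a0 h0 hl0 hl.
have near0 (e : R) : 0 < e -> \forall s \near 0^'+, 0 < s < e.
  move=> e0; near=> s; apply/andP; split; first by near: s; exact: nbhs_right_gt.
  by near: s; exact: nbhs_right_lt.
move: a0; rewrite le_eqVlt => /predU1P[a0|a0].
  have hb (b : R) : 0 < b -> exists2 e : R, 0 < e & forall s, 0 < s < e -> h s <= b.
    move=> b0; have := hl0 (esym a0); move=> hE.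
    have : (limf_esup (fun s : R => (h s / s `^ alpha)%:E) 0^'+ < b%:E)%E.
      by rewrite hE lte_fin.
    move=> /limf_esup_at_right_bound[e e0 [c cb He]]; exists e => // s /He.
    rewrite -a0 powRr0 divr1 => hc; rewrite -lee_fin; apply/ltW.
    exact: le_lt_trans cb.
  split.
    exists 1 => //; have [e e0 He] := hb 1 ltr01; exists e => // s /He.
    by rewrite -a0 powRr0 mulr1.
  apply/cvgr0Pnorm_le => b b0; have [e e0 He] := hb b b0.
  apply: filterS (near0 _ (_ : 0 < Num.min r e)); last by rewrite lt_min r0.
  move=> s /andP[s0]; rewrite lt_min => /andP[sr se].
  by rewrite ger0_norm ?h0 ?s0// He// s0.
have [e e0 [c cy He]] := limf_esup_at_right_bound (hl a0).
have [A A0 HA] : exists2 A : R, 0 <= A & forall s, 0 < s < e -> h s <= A * s `^ alpha.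
  exists (fine (maxe c 0%E)); first by rewrite fine_ge0// le_max lexx orbT.
  move=> s /[dup] /andP[s0 _] /He hc.
  rewrite -ler_pdivrMr ?powR_gt0// -lee_fin fineK; first by rewrite le_max hc.
  rewrite ge0_fin_numE ?le_max ?lexx ?orbT//.
  by rewrite gt_max cy ltry.
split; first by exists A => //; exists e.
apply/cvgr0Pnorm_le => b b0.
(* Chosen so that [(A + 1) * e' ^ alpha = b]; [A] itself may be 0. *)
pose e' := (b / (A + 1)) `^ alpha^-1.
have A1 : 0 < A + 1 by lra.
have bA : 0 < b / (A + 1) by rewrite divr_gt0.
have e'0 : 0 < e' by rewrite powR_gt0.
apply: filterS (near0 _ (_ : 0 < Num.min r (Num.min e e'))); last first.
  by rewrite !lt_min r0 e0.
move=> s /andP[s0]; rewrite !lt_min => /and3P[sr se se'].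
rewrite ger0_norm ?h0 ?s0//; apply: le_trans (HA _ _) _; first by rewrite s0.
have sa : s `^ alpha <= b / (A + 1).
  have -> : b / (A + 1) = e' `^ alpha.
    by rewrite /e' -powRrM mulVf ?gt_eqF// powRr1// ltW.
  by apply: ge0_ler_powR; rewrite ?nnegrE ?ltW.
apply: (@le_trans _ _ (A * (b / (A + 1)))); first by rewrite ler_wpM2l.
by rewrite mulrCA ger_pMr// ler_pdivrMr// mul1r lerDl.
Unshelve. all: by end_near. Qed.

Section probability.
Context {R : realType} d (T : measurableType d) (P : probability T R).

Lemma prob_eq_on (E A B : set T) : measurable E -> measurable A -> measurable B ->
  P E = 1%E -> (forall w, E w -> (A w <-> B w)) -> P A = P B.
Proof.
move=> mE mA mB PE EAB.
have restrict (C : set T) : measurable C -> P C = P (C `&` E).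
  move=> mC; rewrite (measureDI P mC mE).
  suff D0 : P (C `\` E) = 0%E by rewrite [X in (X + _)%E]D0 add0e.
  apply/eqP; rewrite eq_le measure_ge0 andbT.
  have -> : 0%E = P (~` E) by rewrite probability_setC// PE subee.
  by apply: le_measure; rewrite ?inE; [exact: measurableD|exact: measurableC|move=> w []].
rewrite restrict// [RHS]restrict//; congr (P _).
by apply/seteqP; split => w [Cw Ew]; split => //; apply/(EAB w Ew).
Qed.

Lemma integrable_expectation_on (I : set R) (X : {RV P >-> R}) (f : R -> R) :
  measurable I -> measurable_fun I f -> (forall z, I z -> 0 <= f z) ->
  (expectation_on I X f < +oo)%E ->
  P.-integrable setT (EFin \o (fun w => (f \_ I) (X w))).
Proof.
move=> mI mf f0 fy.
have mfX : measurable_fun setT (fun w => (f \_ I) (X w)).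
  apply: measurableT_comp; last exact: measurable_funPT.
  exact/(measurable_restrictT _ _).1.
apply/integrableP; split; first exact/measurable_EFinP.
move: fy; rewrite /expectation_on unlock; apply: le_lt_trans.
rewrite le_eqVlt; apply/orP; left; apply/eqP; apply: eq_integral => w _ /=.
by rewrite patchE; case: ifPn => [/set_mem/f0 h|_]; rewrite ?normr0 ?ger0_norm.
Qed.

Lemma expectation_onE (I : set R) (X : {RV P >-> R}) (f : R -> R) :
  fine (expectation_on I X f) = Rintegral P setT (fun w => (f \_ I) (X w)).
Proof. by rewrite /expectation_on unlock. Qed.

End probability.

(** * Measurability and sign of the partial derivative at t0 *)

Section partial2.
Context {R : realType} (I : set R) (D : R -> R -> R) (t0 r : R) (H h : R -> R).
Hypotheses (D_dev : deviation I D) (r_gt0 : 0 < r)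
  (r_sub : forall t, t0 - r < t < t0 + r -> I t).
Hypothesis D_bound : forall x t : R, I x -> t0 - r < t < t0 + r -> t != t0 ->
  `|(D x t - D x t0) / (t - t0) - partial2 D x t0| <= H x * h `|t - t0|.
Hypothesis h_cvg0 : h x @[x --> 0^'+] --> (0 : R).

Let It0 : I t0. Proof. by apply: r_sub; rewrite ltrBlDr !ltrDl r_gt0. Qed.

(** Steps in ]0, r[ that tend to 0: the difference quotients along them are measurable and negative,
    and both properties pass to the limit, up to equality for the sign. *)
Let e (k : nat) : R := r / 2 * k.+1%:R^-1.

Let e_gt0 k : 0 < e k.
Proof. by rewrite !mulr_gt0 ?invr_gt0 ?ltr0n. Qed.

Let e_lt k : e k < r.
Proof.
have : e k <= r / 2.
  by rewrite ler_piMr ?divr_ge0 ?(ltW r_gt0)// invf_le1 ?ltr0n ?ler1n.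
by move/le_lt_trans; apply; rewrite ltr_pdivrMr// ltr_pMr// ltr1n.
Qed.

Let quotient_cvg z : I z ->
  (D z (t0 + e k) - D z t0) / e k @[k --> \oo] --> partial2 D z t0.
Proof.
move=> Iz.
have e0 : e @ \oo --> 0^'+.
  have ec : e @ \oo --> (0 : R).
    by rewrite -(mulr0 (r / 2)); apply: cvgMl_tmp; exact: cvg_harmonic.
  move=> V [b /= b0 bV]; move/cvgr0Pnorm_lt : ec => /(_ b b0).
  apply: filterS => k ek; apply: bV; last exact: e_gt0.
  by rewrite /= sub0r normrN.
have he : H z * h (e k) @[k --> \oo] --> (0 : R).
  rewrite -(mulr0 (H z)); apply: cvgMl_tmp.
  exact: (cvg_comp _ _ e0 h_cvg0).
apply: cvg_sub0 (cvg_cst _); apply/norm_cvg0P.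
apply: (squeeze_cvgr _ (cvg_cst 0) he); apply: nearW => k.
have := @D_bound z (t0 + e k) Iz.
rewrite (_ : t0 + e k - t0 = e k); last by ring.
rewrite (gtr0_norm (e_gt0 k)) => Hk.
rewrite normr_ge0 /=; apply: Hk.
  by have := e_gt0 k; have := e_lt k; move=> ? ?; apply/andP; split; lra.
by rewrite gt_eqF// ltrDl.
Qed.

Lemma measurable_partial2 : measurable I -> borel_measurable_fst I D ->
  measurable_fun I (fun z => partial2 D z t0).
Proof.
move=> mI mD; apply: (measurable_fun_cvg _ quotient_cvg) => k.
apply: measurable_funM => //; apply: measurable_funB; apply: mD => //.
by apply: r_sub; have := e_gt0 k; have := e_lt k; move=> ? ?; apply/andP; split; lra.
Qed.

Lemma partial2_le0 z : I z -> partial2 D z t0 <= 0.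
Proof.
move=> Iz; apply: (cvgr_to_le (quotient_cvg Iz)); apply: nearW => k.
rewrite pmulr_lle0 ?invr_gt0// subr_le0; apply/ltW.
case: (D_dev.1 _ Iz) => + _; apply => //; last by rewrite ltrDl.
by apply: r_sub; have := e_gt0 k; have := e_lt k; move=> ? ?; apply/andP; split; lra.
Qed.

End partial2.

(** * Asymptotic normality of the deviation means *)

Theorem theorem4p1 (R : realType) (d : measure_display) (T : measurableType d)
    (P : probability T R)
    (I : set R) (I_itv : nondegenerate_interval I)
    (D : R -> R -> R) (D_dev : deviation I D)
    (xi : nat -> {RV P >-> R})
    (xi_indep : independent_RVs xi) (xi_id : identically_distributed xi)
    (* (i) *)
    (D_meas : borel_measurable_fst I D)
    (* (ii) *)
    (xi_I : P (xi 0%N @^-1` I) = 1%E)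
    (xi_ipc : interior_point_condition I D (xi 0%N))
    (* (iii) *)
    (t0 : R) (t0_mean : is_deviation_mean_of I D (xi 0%N) t0)
    (D_diff : differentiable_snd I D t0)
    (r : R) (r_gt0 : 0 < r) (alpha : R) (alpha_ge0 : 0 <= alpha)
    (H : R -> R) (H_ge0 : forall x : R, I x -> 0 <= H x)
    (H_meas : measurable_fun I H)
    (h : R -> R) (h_ge0 : forall s : R, 0 < s < r -> 0 <= h s)
    (r_dom : `]t0 - r, t0 + r[ `<=` deviation_domain I D (xi 0%N))
    (D_bound : forall x t : R, I x -> t0 - r < t < t0 + r -> t != t0 ->
      `|(D x t - D x t0) / (t - t0) - partial2 D x t0| <= H x * h `|t - t0|)
    (h_lim0 : alpha = 0 ->
      limf_esup (fun s : R => (h s / s `^ alpha)%:E) 0^'+ = 0%E)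
    (h_lim : 0 < alpha ->
      (limf_esup (fun s : R => (h s / s `^ alpha)%:E) 0^'+ < +oo)%E)
    (H_int : (expectation_on I (xi 0%N)
                (fun x => H x `^ (2 / (2 + alpha)))%R < +oo)%E)
    (* (iv) *)
    (D2_int : (0 < expectation_on I (xi 0%N) (fun x => D x t0 ^+ 2)%R < +oo)%E)
    (dD_int : (0 < expectation_on I (xi 0%N) (fun x => - partial2 D x t0)%R
                 < +oo)%E) :
  cvg_in_distribution P
    (fun n w => Num.sqrt n%:R *
       (deviation_mean I D (fun i : 'I_n => xi i w) - t0))
    (normal_law 0
       (fine (expectation_on I (xi 0%N) (fun x => D x t0 ^+ 2)) /
        fine (expectation_on I (xi 0%N) (fun x => partial2 D x t0)) ^+ 2)).
Proof.
have [Iitv _] := I_itv.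
have mI : measurable I by exact: is_interval_measurable.
have r_sub t : t0 - r < t < t0 + r -> I t.
  by move=> tr; have [] := r_dom t; rewrite //= in_itv.
have It0 : I t0 by apply: r_sub; rewrite ltrBlDr !ltrDl r_gt0.
have [[A A0 [e1 e10 hA]] hc] := modulus_bound r_gt0 alpha_ge0 h_ge0 h_lim0 h_lim.
have mX : measurable_fun setT (xi 0%N) by exact: measurable_funPT.
have mp2I := measurable_partial2 r_gt0 r_sub D_bound hc mI D_meas.
have p2_le0 := partial2_le0 D_dev r_gt0 r_sub D_bound hc.
pose q := 2 / (2 + alpha).
have q01 : 0 < q <= 1.
  by rewrite /q divr_gt0 ?ler_pdivrMr//; lra.
pose Dp t := (D ^~ t) \_ I.
pose p2 := (fun z => partial2 D z t0) \_ I.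
pose Hq := (fun z => H z `^ q) \_ I.
have mDp t : I t -> measurable_fun setT (Dp t).
  by move=> It; apply/(measurable_restrictT _ _).1 => //; exact: D_meas.
have mp2 : measurable_fun setT p2 by exact/(measurable_restrictT _ _).1.
have mcomp (f : R -> R) : measurable_fun setT f ->
    measurable_fun setT (fun w => f (xi 0%N w)) by move=> mf; exact: measurableT_comp.
have iHq : P.-integrable setT (EFin \o (fun w => Hq (xi 0%N w))).
  apply: integrable_expectation_on H_int => //.
    exact: (measurableT_comp (measurable_powR q) H_meas).
  by move=> z _; exact: powR_ge0.
have iD2 : P.-integrable setT (EFin \o (fun w => Dp t0 (xi 0%N w) ^+ 2)).
  have := @integrable_expectation_on _ _ _ P I (xi 0%N) (fun z => D z t0 ^+ 2) mI _ _
    (andP D2_int).2.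
  rewrite (_ : (fun w => (_ \_ I) (xi 0%N w)) = fun w => Dp t0 (xi 0%N w) ^+ 2).
    apply; first by apply: measurable_funX; exact: D_meas.
    by move=> z _; rewrite sqr_ge0.
  by apply/funext => w; rewrite /Dp !patchE; case: ifP => // _; rewrite expr0n.
have iD : P.-integrable setT (EFin \o (fun w => Dp t0 (xi 0%N w))).
  have := @integrable_expectation_on _ _ _ P I (xi 0%N) (fun z => `|D z t0|) mI _ _
    t0_mean.1.2.
  have mn : measurable_fun I (fun z => `|D z t0|).
    by apply: measurableT_comp => //; exact: D_meas.
  move=> /(_ mn (fun _ _ => normr_ge0 _)); apply: le_integrable => //.
    by apply/measurable_EFinP; apply: mcomp; exact: mDp.
  move=> w _ /=; rewrite lee_fin /Dp !patchE; case: ifP => // _.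
  by rewrite normr_id.
have iNp2 : P.-integrable setT (EFin \o (fun w => - p2 (xi 0%N w))).
  have := @integrable_expectation_on _ _ _ P I (xi 0%N) (fun z => - partial2 D z t0) mI _ _
    (andP dD_int).2.
  rewrite (_ : (fun w => (_ \_ I) (xi 0%N w)) = fun w => - p2 (xi 0%N w)).
    apply; first exact: measurableT_comp.
    by move=> z Iz; rewrite oppr_ge0 p2_le0.
  by apply/funext => w; rewrite /p2 !patchE; case: ifP => // _; rewrite oppr0.
have ip2 : P.-integrable setT (EFin \o (fun w => p2 (xi 0%N w))).
  apply: eq_integrable (integrableN iNp2) => //= w _.
  by rewrite opprK.
pose m := fine (expectation_on I (xi 0%N) (fun x => - partial2 D x t0)).
have m0 : 0 < m by apply: fine_gt0.
pose v := fine (expectation_on I (xi 0%N) (fun x => D x t0 ^+ 2)).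
have v0 : 0 < v by apply: fine_gt0.
have Ep2 : (\int[P]_w p2 (xi 0%N w) = - m)%R.
  rewrite /m expectation_onE.
  rewrite (_ : (fun w => ((fun x => - partial2 D x t0) \_ I) (xi 0%N w)) =
      fun w => -1 * p2 (xi 0%N w)).
    by rewrite RintegralZl// mulN1r opprK.
  by apply/funext => w; rewrite /p2 !patchE mulN1r; case: ifP => // _; rewrite oppr0.
have Ev : (\int[P]_w Dp t0 (xi 0%N w) ^+ 2 = v)%R.
  rewrite /v expectation_onE; congr Rintegral.
  by apply/funext => w; rewrite /Dp !patchE; case: ifP => // _; rewrite expr0n.
have ED : (\int[P]_w Dp t0 (xi 0%N w) = 0)%R.
  by rewrite -expectation_onE t0_mean.2.
rewrite (expectation_onE I (xi 0%N) (fun x => partial2 D x t0)) Ep2 sqrrN -/v.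
split.
  move=> n; apply: measurable_funM => //; apply: measurable_funB => //.
  exact: measurable_deviation_mean.
move=> x cx; rewrite /normal_law.
pose sigma := Num.sqrt (v / m ^+ 2).
have vm0 : 0 < v / m ^+ 2 by rewrite divr_gt0 ?exprn_gt0.
have sigma0 : 0 < sigma by rewrite sqrtr_gt0.
pose s n : R := `|x| / Num.sqrt n%:R.
pose t n : R := t0 + x / Num.sqrt n%:R.
(* For such [n], [t n] lies within [r] of [t0] and [s n] in the range of the growth bound on [h].
   For the others, [g n] is defined as the part in [W] and [U] alone. *)
pose good n := (0 < n)%N && (s n < Num.min r e1).
pose W w := Dp t0 (xi 0%N w) / m.
pose U w := x / m * p2 (xi 0%N w) + x.
pose g n z := if good n then Dp (t n) z / (m * Num.sqrt n%:R) + x / n%:R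
  else Dp t0 z / m / Num.sqrt n%:R + (x / m * p2 z + x) / n%:R.
pose C n w := g n (xi 0%N w) - W w / Num.sqrt n%:R - U w / n%:R.
(* Collects the constants in [|C n| <= |x| / m * H * h (s n) / n] once [h (s n) <= A * s n ^ alpha]
   and [s n = |x| / sqrt n] are inserted; [G] is then [(c * H) ^ q]. *)
pose c := `|x| / m * A * `|x| `^ alpha.
pose G w := c `^ q * Hq (xi 0%N w).
have t_itv n : good n -> t0 - r < t n < t0 + r.
  move=> /andP[n0]; rewrite lt_min => /andP[sr _].
  have : `|x / Num.sqrt n%:R| < r.
    by rewrite normrM (ger0_norm (_ : 0 <= (Num.sqrt n%:R)^-1)) ?invr_ge0.
  by rewrite ltr_norml /t !ltrD2l.
have mg n : measurable_fun setT (g n).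
  rewrite /g; case: (good n) (@t_itv n) => [gn|_].
    apply: measurable_funD => //; apply: measurable_funM => //.
    by apply: mDp; apply: r_sub; exact: gn.
  apply: measurable_funD.
    by apply: measurable_funM => //; apply: measurable_funM => //; exact: mDp.
  by apply: measurable_funM => //; apply: measurable_funD => //; exact: measurable_funM.
have mW : measurable_fun setT W.
  by apply: measurable_funM => //; apply: mcomp; exact: mDp.
have mU : measurable_fun setT U.
  by apply: measurable_funD => //; apply: measurable_funM => //; exact: mcomp.
have mC n : measurable_fun setT (C n).
  apply: measurable_funB; last exact: measurable_funM.
  by apply: measurable_funB; [exact: mcomp|exact: measurable_funM].
have iW2 : P.-integrable setT (EFin \o (fun w => W w ^+ 2)).
  apply: eq_integrable (integrableZl _ (m ^- 2) iD2) => //= w _.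
  by rewrite -EFinM /W expr_div_n mulrC.
have iU : P.-integrable setT (EFin \o U).
  apply: eq_integrable (integrableD _ (integrableZl _ (x / m) ip2)
    (finite_measure_integrable_cst P x _)) => //.
have iG : P.-integrable setT (EFin \o G).
  by apply: eq_integrable (integrableZl _ (c `^ q) iHq).
have W0 : (\int[P]_w W w = 0)%R by rewrite /W RintegralZr// ED mul0r.
have W2 : (\int[P]_w W w ^+ 2 = sigma ^+ 2)%R.
  rewrite (_ : (fun w => W w ^+ 2) = fun w => Dp t0 (xi 0%N w) ^+ 2 * m ^- 2).
    by rewrite RintegralZr// Ev sqr_sqrtr// ltW.
  by apply/funext => w; rewrite /W expr_div_n.
have U0 : (\int[P]_w U w = 0)%R.
  rewrite /U RintegralD//; first last.
  - exact: finite_measure_integrable_cst.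
  - by apply: eq_integrable (integrableZl _ (x / m) ip2).
  rewrite RintegralZl// Ep2 Rintegral_cst// [X in x * fine X]probability_setT mulr1.
  by field; rewrite gt_eqF.
have gE n w : g n (xi 0%N w) = W w / Num.sqrt n%:R + U w / n%:R + C n w.
  by rewrite /C; ring.
(* C is the error term of the differentiability of D at t0; it is forced to be 0
   for the finitely many n such that t n may lie outside ]t0 - r, t0 + r[. *)
have Cdead n w : [|| ~~ good n, xi 0%N w \notin I | x == 0] -> C n w = 0.
  rewrite /C /g /W /U; case: (boolP (good n)) => [|_ _]; last by ring.
  move=> /andP[n0 _] /= /orP[wI|/eqP x0].
    by rewrite /Dp /p2 !patchE (negbTE wI) /= !mul0r mulr0; ring.
  by rewrite /t x0 !mul0r !addr0 !mul0r invfM !mulrA; ring.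
(* As [t n - t0 = x / sqrt n], the error is exactly [x / (m n)] times the difference quotient minus
   the derivative; [x != 0] keeps [t n] away from [t0]. *)
have Cb n w : good n -> I (xi 0%N w) -> x != 0 ->
    `|C n w| <= `|x| / m * (H (xi 0%N w) * h (s n)) * n%:R^-1.
  move=> gn Iw x0; have /andP[n0 _] := gn.
  have nR : (0 : R) < Num.sqrt n%:R by rewrite sqrtr_gt0 ltr0n.
  have n2 : n%:R = Num.sqrt n%:R ^+ 2 :> R by rewrite sqr_sqrtr.
  have tt0 : t n - t0 = x / Num.sqrt n%:R by rewrite /t addrC addKr.
  have u0 : x / Num.sqrt n%:R != 0 by rewrite mulf_neq0// invr_eq0 gt_eqF.
  have -> : C n w = x / m * n%:R^-1 * ((D (xi 0%N w) (t n) - D (xi 0%N w) t0) / (t n - t0)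
       - partial2 D (xi 0%N w) t0).
    rewrite /C /g gn /W /U /Dp /p2 !patchE mem_set// tt0.
    move: nR n2 {tt0 u0}; move: (Num.sqrt n%:R) => a a0 ->.
    by field; rewrite x0 !gt_eqF.
  rewrite !normrM (gtr0_norm (_ : 0 < m^-1)) ?invr_gt0//.
  rewrite (gtr0_norm (_ : 0 < n%:R^-1)) ?invr_gt0 ?ltr0n// mulrAC.
  rewrite ler_wpM2r// ler_wpM2l ?mulr_ge0 ?invr_ge0 ?(ltW m0)//.
  have sE : s n = `|t n - t0|.
    by rewrite tt0 /s normrM (gtr0_norm (_ : 0 < (Num.sqrt n%:R)^-1)) ?invr_gt0.
  rewrite sE; apply: D_bound => //; first exact: t_itv.
  by rewrite -subr_eq0 tt0.
have s_gt0 n : good n -> x != 0 -> 0 < s n.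
  by move=> /andP[n0 _] x0; rewrite divr_gt0 ?normr_gt0// sqrtr_gt0 ltr0n.
have CG n w : n%:R * Num.min 1 `|C n w| <= G w.
  have G0 : 0 <= G w.
    rewrite mulr_ge0 ?powR_ge0// /Hq patchE; case: ifP => // _; exact: powR_ge0.
  case: (boolP [|| ~~ good n, xi 0%N w \notin I | x == 0]) => [/Cdead ->|].
    by rewrite normr0 minC min_l// mulr0.
  rewrite !negb_or !negbK => /and3P[gn wI x0].
  have Iw : I (xi 0%N w) by exact: set_mem.
  have /andP[n0 sn] := gn; move: sn; rewrite lt_min => /andP[sr se].
  have nR : (0 : R) < n%:R by rewrite ltr0n.
  have sp := s_gt0 _ gn x0.
  have c0 : 0 <= c by rewrite !mulr_ge0 ?powR_ge0 ?invr_ge0 ?(ltW m0).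
  have H0 := H_ge0 _ Iw.
  have Cb' : `|C n w| <= (c * H (xi 0%N w)) * (n%:R^-1 * (Num.sqrt n%:R)^-1 `^ alpha).
    apply: le_trans (Cb n w gn Iw x0) _.
    have hs : h (s n) <= A * (`|x| `^ alpha * (Num.sqrt n%:R)^-1 `^ alpha).
      by rewrite -powRM ?invr_ge0//; apply: hA; rewrite sp.
    apply: (@le_trans _ _ (`|x| / m * (H (xi 0%N w) *
        (A * (`|x| `^ alpha * (Num.sqrt n%:R)^-1 `^ alpha))) * n%:R^-1)).
      rewrite ler_wpM2r ?invr_ge0// ler_wpM2l ?mulr_ge0 ?invr_ge0 ?(ltW m0)//.
      by rewrite ler_wpM2l.
    by rewrite le_eqVlt; apply/orP; left; apply/eqP; rewrite /c; ring.
  apply: le_trans (ler_wpM2l (ltW nR) (min1_le_powR (normr_ge0 _) Cb' q01)) _.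
  have cH0 : 0 <= c * H (xi 0%N w) by exact: mulr_ge0.
  have a0 : 0 <= n%:R^-1 * (Num.sqrt n%:R)^-1 `^ alpha.
    by rewrite mulr_ge0 ?invr_ge0 ?powR_ge0.
  rewrite powRM//.
  have pq := powR_invn_invsqrtn n0 alpha_ge0; rewrite -/q in pq; rewrite pq.
  rewrite mulrC divfK ?gt_eqF// powRM//.
  by rewrite /G /Hq patchE mem_set.
have s_cvg : s @ \oo --> (0 : R).
  by rewrite -(mulr0 `|x|); apply: cvgMl_tmp; exact: cvg_invsqrtn.
have good_near : \forall n \near \oo, good n.
  have re0 : 0 < Num.min r e1 by rewrite lt_min r_gt0.
  have n1 : \forall n \near \oo, (0 < n)%N by exists 1%N.
  have n2 : \forall n \near \oo, s n < Num.min r e1 by exact: (cvgr_lt _ s_cvg).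
  have gk k : (0 < k)%N -> s k < Num.min r e1 -> good k.
    by move=> h1 h2; rewrite /good h1.
  exact: (filterS2 _ gk n1 n2).
have C0 w : n%:R * Num.min 1 `|C n w| @[n --> \oo] --> (0 : R).
  case: (boolP ((xi 0%N w \notin I) || (x == 0))) => [wx|].
    rewrite (_ : (fun _ => _) = cst 0); first exact: cvg_cst.
    by apply/funext => n; rewrite Cdead ?wx ?orbT// normr0 minC min_l// mulr0.
  rewrite negb_or negbK => /andP[wI x0].
  have Iw : I (xi 0%N w) by exact: set_mem.
  have hs : `|x| / m * (H (xi 0%N w) * h (s n)) @[n --> \oo] --> (0 : R).
    rewrite -(mulr0 (`|x| / m)) -(mulr0 (H (xi 0%N w))).
    apply: cvgMl_tmp; apply: cvgMl_tmp; apply: (cvg_comp _ _ _ hc).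
    move=> V [b /= b0 bV]; move/cvgr0Pnorm_lt : (s_cvg) => /(_ b b0) sb.
    have Vk k : good k -> `|s k| < b -> V (s k).
      move=> gk sk; apply: bV; last exact: s_gt0.
      by rewrite /= sub0r normrN.
    exact: (filterS2 _ Vk good_near sb).
  apply: (squeeze_cvgr _ (cvg_cst 0) hs); apply: filterS good_near => n gn.
  have n0 : (0 : R) < n%:R by case/andP: gn; rewrite ltr0n.
  rewrite mulr_ge0 ?le_min ?ler01//=.
  rewrite mulrC -ler_pdivlMr//; apply: le_trans (Cb n w gn Iw x0).
  by rewrite ge_min lexx orbT.
have S_cvg : P (partial_sum xi (g n) n @^-1` `]-oo, x]%classic) @[n --> \oo] -->
    normal_prob 0 sigma `]-oo, x]%classic.
  apply: cvg_prob_of_cvg_avg.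
  - by move=> n; exact: measurable_partial_sum.
  - move=> l y l0; have [K [f1 [f2 tf]]] := test_function_logistic l0.
    exact: (cvg_avg_partial_sum xi_indep xi_id sigma0 mg mW mU mC iW2 iU iG
      W0 W2 U0 CG C0 gE tf).
  - exact: cx.
apply: cvg_trans S_cvg; apply: near_eq_cvg; apply: filterS good_near => n gn.
have /andP[n0 _] := gn.
have nR : (0 : R) < n%:R by rewrite ltr0n.
have sR : 0 < Num.sqrt (n%:R : R) by rewrite sqrtr_gt0.
(* The two events are compared only where the whole sample lies in [I], which has probability 1. *)
apply: (@prob_eq_on _ _ _ P (all_in I xi n)).
- exact: measurable_all_in.
- by rewrite -[X in measurable X]setTI; apply: measurable_partial_sum.
- rewrite -[X in measurable X]setTI; apply: measurable_funM => //.
  by apply: measurable_funB => //; exact: measurable_deviation_mean.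
- exact: prob_all_in.
move=> w /all_inP wI; rewrite /preimage /= !in_itv /=.
(* The [n] shifts [x / n] add up to [x], so comparing the row sum with [x] amounts to comparing the
   sum of deviations at [t n] with 0. *)
have -> : partial_sum xi (g n) n w =
    (\sum_(i < n) D (xi i w) (t n)) / (m * Num.sqrt n%:R) + x.
  rewrite /partial_sum (eq_bigr (fun i : 'I_n =>
    D (xi i w) (t n) / (m * Num.sqrt n%:R) + x / n%:R)).
    rewrite big_split /= sumr_const card_ord -mulr_suml; congr (_ + _).
    by rewrite -[LHS]mulr_natr divfK// gt_eqF.
  by move=> i _; rewrite /g gn /Dp patchE mem_set.
rewrite gerDr pmulr_lle0 ?invr_gt0 ?mulr_gt0//.
have It : I (t n) by apply: r_sub; exact: t_itv.
rewrite -(deviation_mean_le Iitv D_dev n0 wI It).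
by rewrite -ler_pdivlMl// mulrC /t lerBlDl.
Qed.
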